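(* The following three identities hold: $$\sum_{n=1}^\infty \sigma_1(n)\left[2\pi n(2\pi n-3)+1\right]e^{-2\pi n}=\frac1{24},$$ $$\sum_{n=1}^\infty \sigma_3(n)\left(\pi n-1\right)e^{-2\pi n}=\frac1{240},$$ $$\sum_{n=1}^\infty \sigma_5(n)\,e^{-2\pi n}=\frac1{504}.$$
   Context: $\sigma_a(n)=\sum_{d\mid n}d^a$ is the divisor function, defined for integers $n\ge1$. *)

(* Defs.v *)
From mathcomp Require Import all_boot.

Definition divisor_sigma (a n : nat) : nat := \sum_(d <- divisors n) d ^ a.

(* Main.v *)
Require Import Defs.
From mathcomp Require all_boot.
From Stdlib Require Import Reals Lra Lia.
From Coquelicot Require Import Coquelicot.
Open Scope R_scope.

(** Let [L_s(y) = sum_n sigma_s(n) n^-s exp(-2 pi n y) = sum_m m^-s / (exp(2 pi m y) - 1)],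
    the Eichler integral of the Eisenstein series of weight [s + 1] on the imaginary axis
    (for [s = 1], the logarithm of the eta function). The partial fractions of [coth] turn
    [L_s(y)] into a double sum over [m, n >= 1] of [1 / (m^(s-1) (m^2 y^2 + n^2))]. For
    [s = 3, 5] everything is positive and convergent, and partial fractions in [m^2], [n^2]
    relate the values at [y] and [1/y] up to an explicit rational function. For [s = 1] the
    double sum diverges; truncated to a square it is symmetric under [y -> 1/y], and the
    discarded tails contribute [(pi/2) ln y]. Differentiating these reciprocity relations
    three, four and five times at the fixed point [y = 1] gives the three identities; the
    constants come from [zeta 2], [zeta 4], [zeta 6], read off the expansion of [coth] at 0. *)

(** Each derivative multiplies the [n]-th coefficient of [L_s] by [-2 pi n], so order [s] restores
    [sigma_s(n)] itself, and each further order adds a factor [n]. At the fixed point the sign of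
    the reciprocity decides which orders say anything: in weight 4 the third-order relation becomes
    [0 = 0] and the fourth is needed; in weight 6 the fifth already gives the value; in weight 2 the
    second order repeats the first, and the third has to be combined with the first to remove the
    constant left by [ln y]. The numbers 24, 240, 504 are, up to sign, the coefficients in the
    Eisenstein series [E_2], [E_4], [E_6]; the third identity says that [E_6] vanishes at [i]. The
    argument stays on the imaginary axis and is entirely real. The partial fractions of [coth] come
    from its duplication formula, iterated and passed to the limit, and every exchange of infinite
    sums is one of nonnegative terms. *)

Ltac real_eq := match goal with |- ?a = ?b => change (a = b :> R) end.

(** * Series *)

(** The range is [k < n], unlike that of the inclusive [sum_n], so that the empty sum, splitting at
    [m + n] and telescoping need no index correction. *)
Fixpoint psum (a : nat -> R) (n : nat) : R :=
  match n with O => 0 | S k => psum a k + a k end.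

Lemma sum_n_psum (a : nat -> R) (n : nat) : sum_n a n = psum a (S n).
Proof.
  induction n as [|n IH].
  - rewrite sum_O. simpl. ring.
  - rewrite sum_Sn, IH. reflexivity.
Qed.

Lemma is_series_psum (a : nat -> R) (l : R) :
  is_series a l <-> is_lim_seq (psum a) l.
Proof.
  split; intros H.
  - apply is_lim_seq_incr_1.
    apply is_lim_seq_ext with (sum_n a); [intros n; apply sum_n_psum | exact H].
  - apply is_lim_seq_incr_1 in H.
    apply is_lim_seq_ext with (u := fun n => psum a (S n)) (v := sum_n a) in H;
      [exact H | intros n; now rewrite sum_n_psum].
Qed.

Lemma psum_ext (a b : nat -> R) (n : nat) :
  (forall k, (k < n)%nat -> a k = b k) -> psum a n = psum b n.
Proof.
  induction n as [|n IH]; intros H; simpl; [reflexivity|].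
  rewrite IH, H; auto.
Qed.

Lemma psum_le (a b : nat -> R) (n : nat) :
  (forall k, (k < n)%nat -> a k <= b k) -> psum a n <= psum b n.
Proof.
  induction n as [|n IH]; intros H; simpl; [lra|].
  apply Rplus_le_compat; auto.
Qed.

Lemma psum_plus (a b : nat -> R) (n : nat) :
  psum (fun k => a k + b k) n = psum a n + psum b n.
Proof. induction n as [|n IH]; simpl; [ring | rewrite IH; ring]. Qed.

Lemma psum_minus (a b : nat -> R) (n : nat) :
  psum (fun k => a k - b k) n = psum a n - psum b n.
Proof. induction n as [|n IH]; simpl; [ring | rewrite IH; ring]. Qed.

Lemma psum_scal (c : R) (a : nat -> R) (n : nat) :
  psum (fun k => c * a k) n = c * psum a n.
Proof. induction n as [|n IH]; simpl; [ring | rewrite IH; ring]. Qed.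

Lemma psum_const (c : R) (n : nat) : psum (fun _ => c) n = INR n * c.
Proof.
  induction n as [|n IH]; [simpl; ring | rewrite S_INR; simpl; rewrite IH; ring].
Qed.

Lemma psum_telescope (u : nat -> R) (n : nat) :
  psum (fun k => u (S k) - u k) n = u n - u O.
Proof. induction n as [|n IH]; simpl; [ring | rewrite IH; ring]. Qed.

Lemma psum_add (a : nat -> R) (m n : nat) :
  psum a (m + n) = psum a m + psum (fun k => a (m + k)%nat) n.
Proof.
  induction n as [|n IH]; [rewrite Nat.add_0_r; simpl; ring|].
  rewrite Nat.add_succ_r; simpl; rewrite IH; ring.
Qed.

Lemma psum_rev (a : nat -> R) (n : nat) :
  psum (fun k => a (n - 1 - k)%nat) n = psum a n.
Proof.
  induction n as [|n IH]; [reflexivity|].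
  transitivity (psum (fun k => a (S n - 1 - k)%nat) (1 + n)); [reflexivity|].
  rewrite psum_add; cbn [psum].
  rewrite (psum_ext _ (fun k => a (n - 1 - k)%nat)) by (intros k Hk; f_equal; lia).
  rewrite IH, Nat.sub_succ, !Nat.sub_0_r; ring.
Qed.

Lemma psum_swap (u : nat -> nat -> R) (m n : nat) :
  psum (fun i => psum (u i) n) m = psum (fun j => psum (fun i => u i j) m) n.
Proof.
  induction m as [|m IH]; simpl.
  - rewrite psum_const; ring.
  - rewrite IH, <- psum_plus; reflexivity.
Qed.

Lemma psum_le_series (a : nat -> R) (l : R) (n : nat) :
  (forall k, 0 <= a k) -> is_series a l -> psum a n <= l.
Proof.
  intros Ha H; apply is_series_psum in H.
  apply (is_lim_seq_incr_compare _ _ H).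
  intros k; specialize (Ha k); change (psum a k <= psum a k + a k); lra.
Qed.

Lemma is_series_tail (a : nat -> R) (l : R) (n : nat) :
  is_series a l -> is_series (fun k => a (n + k)%nat) (l - psum a n).
Proof.
  intros H; apply is_series_psum; apply is_series_psum in H.
  apply is_lim_seq_ext with (fun k => psum a (k + n)%nat - psum a n).
  - intros k; rewrite Nat.add_comm, psum_add; ring.
  - apply is_lim_seq_minus' ; [now apply is_lim_seq_incr_n | apply is_lim_seq_const].
Qed.

Lemma is_series_finite (a : nat -> R) (n : nat) :
  (forall k, (n <= k)%nat -> a k = 0) -> is_series a (psum a n).
Proof.
  intros H; apply is_series_psum, (is_lim_seq_incr_n _ n).
  apply is_lim_seq_ext with (fun _ => psum a n); [|apply is_lim_seq_const].
  intros k; rewrite Nat.add_comm, psum_add.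
  rewrite (psum_ext (fun k => a (n + k)%nat) (fun _ => 0)) by (intros; apply H; lia).
  rewrite psum_const; ring.
Qed.

Lemma is_series_le (a b : nat -> R) (la lb : R) :
  (forall k, a k <= b k) -> is_series a la -> is_series b lb -> la <= lb.
Proof.
  intros H Ha Hb; apply is_series_psum in Ha; apply is_series_psum in Hb.
  apply (is_lim_seq_le _ _ (Finite la) (Finite lb) (fun n => psum_le a b n (fun k _ => H k)) Ha Hb).
Qed.

Lemma ex_series_nonneg_le (a b : nat -> R) :
  (forall k, 0 <= a k <= b k) -> ex_series b -> ex_series a.
Proof.
  intros H; apply (ex_series_le a b); intros k.
  change (norm (a k)) with (Rabs (a k)); rewrite Rabs_pos_eq; apply H.
Qed.

(** Dominated convergence for series. One cutoff [K], chosen from the tail of [b], makes the tails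
    of all [a n] and of [l] small at once; what is left is a finite sum, which converges term by
    term. *)
Lemma tannery (a : nat -> nat -> R) (l b : nat -> R) :
  (forall n k, Rabs (a n k) <= b k) -> ex_series b ->
  (forall k, is_lim_seq (fun n => a n k) (l k)) ->
  is_lim_seq (fun n => Series (a n)) (Series l).
Proof.
  intros Hab [B HB] Hl.
  assert (Hlb : forall k, Rabs (l k) <= b k).
  { intros k.
    apply (is_lim_seq_le (fun n => Rabs (a n k)) (fun _ => b k) (Rabs (l k)) (b k)).
    - intros n; apply Hab.
    - apply (is_lim_seq_abs _ (l k)), Hl.
    - apply is_lim_seq_const. }
  assert (exb : ex_series b) by (exists B; exact HB).
  assert (exa : forall n, ex_series (a n))
    by (intros n; apply (ex_series_le (a n) b); [apply Hab | exact exb]).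
  assert (exl : ex_series l) by (apply (ex_series_le l b); [apply Hlb | exact exb]).
  apply is_lim_seq_spec; intros eps.
  assert (HB' := HB); apply is_series_psum in HB'.
  apply is_lim_seq_spec in HB'.
  assert (He : 0 < eps / 4) by (generalize (cond_pos eps); lra).
  destruct (HB' (mkposreal _ He)) as [K HK]; simpl in HK.
  specialize (HK K (Nat.le_refl K)).
  assert (Hfin : is_lim_seq (fun n => psum (a n) K) (psum l K)).
  { clear HK; induction K as [|K IH]; simpl; [apply is_lim_seq_const|].
    apply is_lim_seq_plus'; [exact IH | apply Hl]. }
  apply is_lim_seq_spec in Hfin.
  destruct (Hfin (mkposreal _ He)) as [N HN]; simpl in HN.
  exists N; intros n Hn; specialize (HN n Hn).
  assert (Htail : forall c : nat -> R, (forall k, Rabs (c k) <= b k) -> ex_series c ->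
            Rabs (Series c - psum c K) < eps / 4).
  { intros c Hc exc.
    assert (H1 := is_series_tail c _ K (Series_correct _ exc)).
    assert (H2 := is_series_tail b _ K HB).
    assert (H3 : ex_series (fun k => Rabs (c (K + k)%nat))).
    { apply (ex_series_le (fun k => Rabs (c (K + k)%nat)) (fun k => b (K + k)%nat)).
      - intros k; change (norm (Rabs (c (K + k)%nat))) with (Rabs (Rabs (c (K + k)%nat)));
        rewrite Rabs_Rabsolu; apply Hc.
      - eexists; exact H2. }
    rewrite <- (is_series_unique _ _ H1).
    apply Rle_lt_trans with (1 := Series_Rabs _ H3).
    apply Rle_lt_trans with (B - psum b K).
    - apply (is_series_le _ _ _ _ (fun k => Hc (K + k)%nat) (Series_correct _ H3) H2).
    - apply Rabs_def2 in HK; lra. }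
  assert (T1 := Htail (a n) (Hab n) (exa n)).
  assert (T2 := Htail l Hlb exl).
  apply Rabs_def2 in T1; apply Rabs_def2 in T2; apply Rabs_def2 in HN.
  apply Rabs_def1; lra.
Qed.

(** Extending the rows by zero beyond [L n] keeps the domination and eventually leaves each fixed
    column unchanged. This form serves the finite sums for [coth], whose terms are controlled only
    for [k < 2 ^ j]. *)
Lemma tannery_psum (a : nat -> nat -> R) (l b : nat -> R) (L : nat -> nat) :
  (forall n k, (k < L n)%nat -> Rabs (a n k) <= b k) -> ex_series b ->
  (forall k, is_lim_seq (fun n => a n k) (l k)) ->
  (forall k, eventually (fun n => (k < L n)%nat)) ->
  is_lim_seq (fun n => psum (a n) (L n)) (Series l).
Proof.
  intros Hab Hb Hl HL.
  assert (b0 : forall k, 0 <= b k).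
  { intros k; destruct (HL k) as [N HN].
    apply Rle_trans with (2 := Hab N k (HN N (Nat.le_refl N))); apply Rabs_pos. }
  set (a' := fun n k => if (k <? L n)%nat then a n k else 0).
  apply is_lim_seq_ext with (fun n => Series (a' n)).
  - intros n.
    rewrite (psum_ext _ (a' n)).
    + apply is_series_unique, is_series_finite; intros k Hk; unfold a'.
      destruct (Nat.ltb_spec k (L n)); [lia | reflexivity].
    + intros k Hk; unfold a'; destruct (Nat.ltb_spec k (L n)); [reflexivity | lia].
  - apply tannery with b; [ | exact Hb | ].
    + intros n k; unfold a'; destruct (Nat.ltb_spec k (L n)); [now apply Hab|].
      rewrite Rabs_R0; apply b0.
    + intros k; apply is_lim_seq_ext_loc with (fun n => a n k); [|apply Hl].
      destruct (HL k) as [N HN]; exists N; intros n Hn; unfold a'.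
      specialize (HN n Hn); destruct (Nat.ltb_spec k (L n)); [reflexivity | lia].
Qed.

Lemma series_psum_swap (u : nat -> nat -> R) (n : nat) :
  (forall j, ex_series (fun i => u i j)) ->
  is_series (fun i => psum (u i) n) (psum (fun j => Series (fun i => u i j)) n).
Proof.
  intros H; induction n as [|n IH]; simpl.
  - apply (is_series_finite (fun _ => 0) 0); reflexivity.
  - apply (is_series_plus (fun i => psum (u i) n) (fun i => u i n)); [exact IH|].
    apply Series_correct, H.
Qed.

Lemma fubini_nonneg_ex (u : nat -> nat -> R) (r : nat -> R) (j : nat) :
  (forall i k, 0 <= u i k) -> (forall i, is_series (u i) (r i)) -> ex_series r ->
  ex_series (fun i => u i j).
Proof.
  intros Hu Hr; apply ex_series_nonneg_le; intros i; split; [apply Hu|].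
  apply Rle_trans with (psum (u i) (S j)).
  - simpl. assert (0 <= psum (u i) j); [|lra].
    rewrite <- (Rmult_0_r (INR j)), <- psum_const; apply psum_le; intros; apply Hu.
  - apply psum_le_series; [apply Hu | apply Hr].
Qed.

(** For finitely many columns the exchange is linearity. The partial row sums are dominated by the
    full row sums [r], so [tannery] lets the number of columns grow under the outer sum. *)
Lemma fubini_nonneg (u : nat -> nat -> R) (r : nat -> R) (l : R) :
  (forall i j, 0 <= u i j) -> (forall i, is_series (u i) (r i)) -> is_series r l ->
  is_series (fun j => Series (fun i => u i j)) l.
Proof.
  intros Hu Hr Hl.
  assert (exr : ex_series r) by (exists l; exact Hl).
  assert (Hcol : forall j, ex_series (fun i => u i j))
    by (intros j; apply (fubini_nonneg_ex u r j); assumption).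
  apply is_series_psum; rewrite <- (is_series_unique _ _ Hl).
  apply is_lim_seq_ext with (fun n => Series (fun i => psum (u i) n)).
  - intros n; apply is_series_unique, series_psum_swap, Hcol.
  - apply tannery with r; [ | exact exr | ].
    + intros n i; rewrite Rabs_pos_eq.
      * apply psum_le_series; [apply Hu | apply Hr].
      * rewrite <- (Rmult_0_r (INR n)), <- psum_const; apply psum_le; intros; apply Hu.
    + intros i; apply is_series_psum, Hr.
Qed.

Lemma fubini_nonneg_cols (u : nat -> nat -> R) (r c : nat -> R) (l : R) :
  (forall i j, 0 <= u i j) -> (forall i, is_series (u i) (r i)) -> is_series r l ->
  (forall j, is_series (fun i => u i j) (c j)) -> is_series c l.
Proof.
  intros Hu Hr Hl Hc.
  apply is_series_ext with (2 := fubini_nonneg u r l Hu Hr Hl).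
  intros j; now apply is_series_unique.
Qed.

Lemma INR_S_ge_1 (n : nat) : 1 <= INR (S n).
Proof. rewrite S_INR; generalize (pos_INR n); lra. Qed.

Lemma is_series_telescope (u : nat -> R) :
  is_lim_seq u 0 -> is_series (fun k => u k - u (S k)) (u O).
Proof.
  intros H; apply is_series_psum.
  apply is_lim_seq_ext with (fun n => u O - u n).
  - induction n as [|n IH]; simpl; [ring | rewrite <- IH; ring].
  - replace (Finite (u O)) with (Finite (u O - 0)) by (f_equal; ring).
    apply is_lim_seq_minus'; [apply is_lim_seq_const | exact H].
Qed.

Lemma is_lim_seq_inv_S : is_lim_seq (fun n => / INR (S n)) 0.
Proof.
  apply (is_lim_seq_incr_1 (fun n => / INR n)).
  change (Finite 0) with (Rbar_inv p_infty).
  apply is_lim_seq_inv; [apply is_lim_seq_INR | discriminate].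
Qed.

Lemma ex_series_inv_sqr : ex_series (fun n => / INR (S n) ^ 2).
Proof.
  apply ex_series_nonneg_le with (fun n => scal 2 (/ INR (S n) - / INR (S (S n)))).
  - intros n; assert (H := INR_S_ge_1 n); split.
    + left; apply Rinv_0_lt_compat; nra.
    + rewrite (S_INR (S n)); 
      change (scal 2 (/ INR (S n) - / (INR (S n) + 1)))
        with (2 * (/ INR (S n) - / (INR (S n) + 1))).
      replace (2 * (/ INR (S n) - / (INR (S n) + 1))) with (/ (INR (S n) * (INR (S n) + 1) / 2))
        by (field; lra).
      apply Rinv_le_contravar; nra.
  - apply (ex_series_scal_l 2 (fun n => / INR (S n) - / INR (S (S n)))).
    eexists; apply (is_series_telescope (fun n => / INR (S n))), is_lim_seq_inv_S.
Qed.

(** * Partial fractions of the hyperbolic cotangent *)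

Lemma cosh_sqr (x : R) : cosh x ^ 2 = 1 + sinh x ^ 2.
Proof.
  assert (H := exp_plus x (- x)); rewrite Rplus_opp_r, exp_0 in H.
  unfold cosh, sinh; nra.
Qed.

Lemma sinh_double (x : R) : sinh (2 * x) = 2 * sinh x * cosh x.
Proof.
  unfold cosh, sinh; replace (- (2 * x)) with (- x + - x) by ring.
  replace (2 * x) with (x + x) by ring; rewrite !exp_plus; field.
Qed.

Lemma cosh_double (x : R) : cosh (2 * x) = 1 + 2 * sinh x ^ 2.
Proof.
  assert (H := exp_plus x (- x)); rewrite Rplus_opp_r, exp_0 in H.
  unfold cosh, sinh; replace (- (2 * x)) with (- x + - x) by ring.
  replace (2 * x) with (x + x) by ring; rewrite !exp_plus; nra.
Qed.

Lemma sinh_pos (x : R) : 0 < x -> 0 < sinh x.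
Proof. intros H; rewrite <- sinh_0; now apply sinh_lt. Qed.

Lemma cosh_pos (x : R) : 0 < cosh x.
Proof. unfold cosh; generalize (exp_pos x) (exp_pos (- x)); lra. Qed.

Lemma cosh_ge_1 (x : R) : 1 <= cosh x.
Proof. generalize (cosh_sqr x) (cosh_pos x); nra. Qed.

Lemma cosh_le (x y : R) : 0 <= x <= y -> cosh x <= cosh y.
Proof.
  intros H.
  assert (Hs : 0 <= sinh x <= sinh y).
  { split.
    - rewrite <- sinh_0; 
      destruct (Rle_lt_or_eq_dec 0 x) as [h|h]; [lra | left; now apply sinh_lt | subst; lra].
    - destruct (Rle_lt_or_eq_dec x y) as [h|h]; [lra | left; now apply sinh_lt | subst; lra]. }
  generalize (cosh_sqr x) (cosh_sqr y) (cosh_pos x) (cosh_pos y); nra.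
Qed.

Lemma sinh_le (x : R) : 0 < x -> sinh x <= x * cosh x.
Proof.
  intros Hx.
  destruct (MVT_cor2 sinh cosh 0 x Hx) as [c [Hc1 Hc2]].
  - intros c _; apply derivable_pt_lim_sinh.
  - rewrite sinh_0 in Hc1.
    assert (cosh c <= cosh x) by (apply cosh_le; lra); nra.
Qed.

(** Weaker than Jordan's inequality, but immediate from [sin t >= t - t^3 / 6]: since [PI <= 4],
    [t <= 2] and [1 - t^2 / 6 >= 1 / 3]. *)
Lemma sin_ge_third (t : R) : 0 <= t <= PI / 2 -> t / 3 <= sin t.
Proof.
  intros Ht; assert (Hpi := PI_4); assert (Hpi0 := PI_RGT_0).
  destruct (sin_bound t 0) as [H _]; [lra | lra|].
  apply Rle_trans with (2 := H).
  unfold sin_approx, sin_term; simpl; nra.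
Qed.

(* The real part of [coth (x + i t)]. *)
Definition coth_kernel (x t : R) : R :=
  sinh x * cosh x / (sinh x ^ 2 + sin t ^ 2).

(** The real part of [2 coth (2 z) = coth z + coth (z + i pi / 2)] at [z = x + i t]. *)
Lemma coth_kernel_double (x t : R) : 0 < x ->
  2 * coth_kernel (2 * x) (2 * t) = coth_kernel x t + coth_kernel x (t + PI / 2).
Proof.
  intros Hx; unfold coth_kernel.
  rewrite sinh_double, cosh_double, sin_2a.
  replace (sin (t + PI / 2)) with (cos t)
    by (rewrite sin_plus, cos_PI2, sin_PI2; ring).
  assert (Hs := sinh_pos x Hx); assert (Hc := cosh_pos x).
  assert (HC := cosh_sqr x); assert (Ht := sin2_cos2 t); unfold Rsqr in Ht.
  set (s := sinh x) in *; set (c := cosh x) in *.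
  set (u := sin t) in *; set (v := cos t) in *.
  assert (HA : 0 < s ^ 2 + u ^ 2) by nra.
  assert (HB : 0 < s ^ 2 + v ^ 2) by nra.
  replace ((2 * s * c) ^ 2 + (2 * u * v) ^ 2) with (4 * (s ^ 2 + u ^ 2) * (s ^ 2 + v ^ 2)).
  2: { replace ((2 * s * c) ^ 2) with (4 * s ^ 2 * c ^ 2) by ring; rewrite HC.
       replace 1 with (u * u + v * v); ring. }
  replace (1 + 2 * s ^ 2) with ((s ^ 2 + u ^ 2) + (s ^ 2 + v ^ 2)) by lra.
  field; split; lra.
Qed.

Lemma INR_pow2 (j : nat) : INR (2 ^ j) = 2 ^ j.
Proof. rewrite pow_INR; reflexivity. Qed.

(** The duplication formula iterated [j] times. Powers of two are enough, because only one sequence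
    of moduli tending to infinity is used in the limit. *)
Lemma coth_kernel_multi (j : nat) (x t : R) : 0 < x ->
  2 ^ j * coth_kernel (2 ^ j * x) (2 ^ j * t)
  = psum (fun k => coth_kernel x (t + PI * INR k / 2 ^ j)) (2 ^ j).
Proof.
  revert x t; induction j as [|j IH]; intros x t Hx.
  - simpl; rewrite !Rmult_1_l, Rplus_0_l; f_equal; field.
  - assert (Hp : 0 < 2 ^ j) by (apply pow_lt; lra).
    replace (2 ^ S j)%nat with (2 ^ j + 2 ^ j)%nat by (simpl; lia).
    change (2 ^ S j)%R with (2 * 2 ^ j).
    replace (2 * 2 ^ j * x) with (2 ^ j * (2 * x)) by ring.
    replace (2 * 2 ^ j * t) with (2 ^ j * (2 * t)) by ring.
    rewrite Rmult_assoc, IH, <- psum_scal, psum_add, <- psum_plus by lra.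
    apply psum_ext; intros k _.
    replace (2 * t + PI * INR k / 2 ^ j) with (2 * (t + PI * INR k / (2 * 2 ^ j)))
      by (field; lra).
    rewrite coth_kernel_double by exact Hx; f_equal; f_equal.
    rewrite plus_INR, INR_pow2; field; lra.
Qed.

(* [coth x] is the average of [coth ((x + i pi k) / 2^(j+1))] over the residues [k] modulo
   [2^(j+1)]; the residues [k] and [-k] have been paired. *)
Lemma coth_finite (j : nat) (x : R) : 0 < x ->
  let h := / 2 ^ S j in
  cosh x / sinh x
  = psum (fun k => 2 * h * coth_kernel (x * h) (PI * INR (S k) * h)) (2 ^ j)
    + h * (cosh (x * h) / sinh (x * h) - sinh (x * h) / cosh (x * h)).
Proof.
  intros Hx h.
  assert (HD : 0 < 2 ^ S j) by (apply pow_lt; lra).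
  assert (Hh : 0 < h) by (apply Rinv_0_lt_compat, HD).
  assert (Hxh : 0 < x * h) by nra.
  assert (HN : INR (2 ^ j) * h = / 2).
  { unfold h; rewrite INR_pow2; simpl; assert (0 < 2 ^ j) by (apply pow_lt; lra); field; lra. }
  assert (E := coth_kernel_multi (S j) (x * h) 0 Hxh).
  replace (2 ^ S j * (x * h)) with x in E by (unfold h; field; lra).
  rewrite Rmult_0_r in E.
  replace (2 ^ S j)%nat with (2 ^ j + 2 ^ j)%nat in E by (simpl; lia).
  rewrite psum_add in E.
  set (N := (2 ^ j)%nat) in *.
  set (f := fun k => coth_kernel (x * h) (PI * INR k * h)).
  rewrite (psum_ext _ f) in E
    by (intros k _; unfold f, h; f_equal; field; lra).
  (* Read backwards, the second half runs through the residues [2 N - (k + 1)];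
     [sin (PI - t) = sin t] identifies each with the residue [k + 1]. *)
  rewrite <- (psum_rev (fun k => coth_kernel (x * h) (0 + PI * INR (N + k) / 2 ^ S j))) in E.
  rewrite (psum_ext (fun k => coth_kernel (x * h) (0 + PI * INR (N + (N - 1 - k)) / 2 ^ S j))
    (fun k => f (S k))) in E.
  2: { intros k Hk; unfold f, coth_kernel; do 2 f_equal; apply (f_equal (fun s => s ^ 2)).
       replace (0 + PI * INR (N + (N - 1 - k)) / 2 ^ S j)
         with (PI - PI * INR (S k) * h); [now rewrite sin_PI_x|].
       replace (INR (N + (N - 1 - k))) with (2 * INR N - INR (S k)).
       - replace PI with (2 * PI * (INR N * h)) at 1 by (rewrite HN; field).
         unfold h; field; lra.
       - replace (N + (N - 1 - k))%nat with (2 * N - S k)%nat by lia.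
         rewrite minus_INR, mult_INR by lia; simpl (INR 2); ring. }
  assert (T := psum_telescope f N).
  (* The first half covers the residues [0..N-1], the folded second half [1..N]. Aligning them
     leaves the end terms [f 0], a [coth], and [f N], a [tanh]. *)
  assert (T' : psum f N = psum (fun k => f (S k)) N + (f O - f N)).
  { replace (f O - f N) with (- psum (fun k => f (S k) - f k) N) by (rewrite T; ring).
    rewrite <- (Rmult_1_l (psum (fun k => f (S k) - f k) N)), <- Ropp_mult_distr_l_reverse,
      <- psum_scal, <- psum_plus.
    apply psum_ext; intros; ring. }
  assert (Hs := sinh_pos _ Hxh); assert (Hc := cosh_pos (x * h)).
  assert (F0 : f O = cosh (x * h) / sinh (x * h)).
  { unfold f, coth_kernel; simpl (INR 0); rewrite Rmult_0_r, Rmult_0_l, sin_0; field; lra. }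
  assert (FN : f N = sinh (x * h) / cosh (x * h)).
  { unfold f, coth_kernel; rewrite Rmult_assoc, HN.
    change (PI * / 2) with (PI / 2); rewrite sin_PI2.
    replace (sinh (x * h) ^ 2 + 1 ^ 2) with (cosh (x * h) ^ 2) by (rewrite cosh_sqr; ring).
    field; lra. }
  rewrite <- F0, <- FN.
  rewrite (psum_ext _ (fun k => (2 * h) * f (S k))) by (intros; unfold f; ring).
  rewrite psum_scal.
  assert (K0 : coth_kernel x 0 = cosh x / sinh x).
  { unfold coth_kernel; rewrite sin_0; generalize (sinh_pos x Hx); intros; field; lra. }
  rewrite K0, T' in E.
  apply (Rmult_eq_reg_l (2 ^ S j)); [|lra].
  rewrite E; unfold h; field; lra.
Qed.

Lemma is_lim_seq_ratio (f : R -> R) (d : R) (h : nat -> R) :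
  is_derive f 0 d -> f 0 = 0 -> is_lim_seq h 0 -> (forall n, h n <> 0) ->
  is_lim_seq (fun n => f (h n) / h n) d.
Proof.
  intros Hd Hf Hh Hn.
  apply is_derive_Reals in Hd.
  apply is_lim_seq_spec; intros eps.
  destruct (Hd eps (cond_pos eps)) as [del Hdel].
  apply is_lim_seq_spec in Hh; destruct (Hh del) as [N HN].
  exists N; intros n Hnn; specialize (HN n Hnn); rewrite Rminus_0_r in HN.
  specialize (Hdel (h n) (Hn n) HN).
  now rewrite Rplus_0_l, Hf, Rminus_0_r in Hdel.
Qed.

(** The limit of [coth_finite] as [h -> 0]: each kernel term tends to a term of the series, and the
    unpaired [h coth (X h)] tends to [1 / X], which produces [1 / x]. *)
Lemma coth_series (x : R) : 0 < x ->
  is_series (fun n => 2 * x / (x ^ 2 + INR (S n) ^ 2))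
    (PI * (cosh (PI * x) / sinh (PI * x)) - 1 / x).
Proof.
  intros Hx; assert (Hpi := PI_RGT_0).
  set (X := PI * x); assert (HX : 0 < X) by (unfold X; nra).
  set (h := fun j : nat => / 2 ^ S j).
  assert (hpos : forall j, 0 < h j)
    by (intros j; apply Rinv_0_lt_compat, pow_lt; lra).
  assert (hle : forall j, h j <= 1).
  { intros j; unfold h; rewrite <- Rinv_1; apply Rinv_le_contravar; [lra|].
    apply pow_R1_Rle; lra. }
  assert (hlim : is_lim_seq h 0).
  { unfold h; apply (is_lim_seq_incr_1 (fun j => / 2 ^ j)).
    apply is_lim_seq_ext with (fun j => (/ 2) ^ j).
    - intros j; apply pow_inv.
    - apply is_lim_seq_geom; rewrite Rabs_pos_eq; lra. }
  assert (hne : forall j, h j <> 0) by (intros j; apply Rgt_not_eq, hpos).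
  assert (Lsinh : is_lim_seq (fun j => sinh (X * h j) / h j) X).
  { apply (is_lim_seq_ratio (fun t => sinh (X * t)) X h); auto.
    - evar_last.
      + apply (is_derive_comp sinh (fun t => X * t) 0 (cosh (X * 0)) X).
        * apply is_derive_Reals, derivable_pt_lim_sinh.
        * auto_derive; auto; ring.
      + change (X * cosh (X * 0) = X); rewrite Rmult_0_r, cosh_0; ring.
    - now rewrite Rmult_0_r, sinh_0. }
  assert (Lsin : forall a, is_lim_seq (fun j => sin (a * h j) / h j) a).
  { intros a; apply (is_lim_seq_ratio (fun t => sin (a * t)) a h); auto.
    - auto_derive; auto; rewrite Rmult_0_r, cos_0; ring.
    - now rewrite Rmult_0_r, sin_0. }
  assert (Lcosh : is_lim_seq (fun j => cosh (X * h j)) 1).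
  { rewrite <- cosh_0.
    apply (is_lim_seq_continuous cosh (fun j => X * h j) 0).
    - apply derivable_continuous_pt, derivable_pt_cosh.
    - replace 0 with (X * 0) by ring.
      apply (is_lim_seq_mult' (fun _ => X) h X 0); [apply is_lim_seq_const | exact hlim]. }
  set (a := fun (j k : nat) => 2 * h j * coth_kernel (X * h j) (PI * INR (S k) * h j)).
  set (l := fun k : nat => 2 * x / (PI * (x ^ 2 + INR (S k) ^ 2))).
  assert (Hk : forall k, 1 <= INR (S k)) by (intros k; rewrite S_INR; generalize (pos_INR k); lra).
  assert (Hlim : forall k, is_lim_seq (fun j => a j k) (l k)).
  { intros k; specialize (Hk k).
    apply is_lim_seq_ext with (fun j => 2 * (sinh (X * h j) / h j) * cosh (X * h j)
       / ((sinh (X * h j) / h j) ^ 2 + (sin (PI * INR (S k) * h j) / h j) ^ 2)).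
    - intros j; unfold a, coth_kernel.
      assert (0 < sinh (X * h j)) by (apply sinh_pos; generalize (hpos j); nra).
      specialize (hne j); field; repeat split; try exact hne; apply Rgt_not_eq; nra.
    - replace (l k) with (2 * X * 1 / (X ^ 2 + (PI * INR (S k)) ^ 2)).
      2: { unfold l, X.
           assert (0 < x ^ 2 + INR (S k) ^ 2) by nra.
           assert (0 < PI ^ 2 * (x ^ 2 + INR (S k) ^ 2)) by (apply Rmult_lt_0_compat; nra).
           field; repeat split; apply Rgt_not_eq; nra. }
      assert (0 < PI * INR (S k)) by nra.
      apply is_lim_seq_div'.
      + apply is_lim_seq_mult'; [|exact Lcosh].
        apply is_lim_seq_mult'; [apply is_lim_seq_const | exact Lsinh].
      + apply is_lim_seq_plus';
          apply (is_lim_seq_continuous (fun t => t ^ 2)); auto;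
          apply derivable_continuous_pt, derivable_pt_pow.
      + nra. }
  (* The numerator is at most [X h cosh(X)^2] by [sinh_le], the denominator at least
     [(PI n h / 3)^2] by [sin_ge_third]; with the factor [2 h] all powers of [h] cancel. *)
  set (C := 18 * X * cosh X ^ 2 / PI ^ 2).
  assert (Hbound : forall j k, (k < 2 ^ j)%nat -> Rabs (a j k) <= C * / INR (S k) ^ 2).
  { intros j k Hkj; specialize (Hk k); specialize (hpos j); specialize (hle j).
    assert (Hs : 0 < sinh (X * h j)) by (apply sinh_pos; nra).
    assert (Hc := cosh_pos (X * h j)).
    assert (Hsin : PI * INR (S k) * h j / 3 <= sin (PI * INR (S k) * h j)).
    { apply sin_ge_third; split; [apply Rmult_le_pos; nra|].
      assert (HN : INR (S k) <= 2 ^ j).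
      { rewrite <- INR_pow2; apply le_INR; lia. }
      assert (HD : 0 < 2 ^ j) by (apply pow_lt; lra).
      assert (INR (S k) * h j <= / 2).
      { apply Rle_trans with (2 ^ j * h j); [nra|].
        unfold h; simpl; right; field; lra. }
      rewrite Rmult_assoc; nra. }
    assert (Hu : 0 < PI * INR (S k) * h j) by (apply Rmult_lt_0_compat; nra).
    assert (Hden : (PI * INR (S k) * h j) ^ 2 / 9
       <= sinh (X * h j) ^ 2 + sin (PI * INR (S k) * h j) ^ 2) by nra.
    set (u := PI * INR (S k) * h j) in *.
    assert (Hu2 : 0 < u ^ 2 / 9) by nra.
    unfold a, coth_kernel; fold u.
    rewrite Rabs_pos_eq.
    2: { apply Rmult_le_pos; [lra|]; apply Rdiv_le_0_compat; nra. }
    assert (Hsc : sinh (X * h j) * cosh (X * h j) <= X * h j * cosh X ^ 2).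
    { assert (H1 := sinh_le (X * h j)); assert (H2 : cosh (X * h j) <= cosh X)
        by (apply cosh_le; nra).
      apply Rle_trans with (X * h j * cosh (X * h j) * cosh (X * h j)).
      - apply Rmult_le_compat_r; nra.
      - rewrite Rmult_assoc; apply Rmult_le_compat_l; nra. }
    apply Rle_trans with (2 * h j * (X * h j * cosh X ^ 2 / (u ^ 2 / 9))).
    - apply Rmult_le_compat_l; [lra|].
      apply Rmult_le_compat; [nra | left; apply Rinv_0_lt_compat; lra | exact Hsc |].
      apply Rinv_le_contravar; assumption.
    - right; unfold C, u; field; split; [|split]; lra. }
  assert (exC : ex_series (fun k => C * / INR (S k) ^ 2)).
  { apply (ex_series_scal_l C (fun k => / INR (S k) ^ 2)), ex_series_inv_sqr. }
  assert (HT := tannery_psum a l _ (fun j => (2 ^ j)%nat) Hbound exC Hlim).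
  assert (HT' : is_lim_seq (fun j => psum (a j) (2 ^ j)) (Series l)).
  { apply HT; intros k; exists k; intros n Hn.
    apply Nat.le_lt_trans with n; [exact Hn | apply Nat.pow_gt_lin_r; lia]. }
  assert (HR : is_lim_seq (fun j => cosh X / sinh X
       - h j * (cosh (X * h j) / sinh (X * h j) - sinh (X * h j) / cosh (X * h j)))
       (cosh X / sinh X - (1 / X - 0))).
  { apply is_lim_seq_minus'; [apply is_lim_seq_const|].
    apply is_lim_seq_ext with (fun j => cosh (X * h j) / (sinh (X * h j) / h j)
       - (sinh (X * h j) / h j) * (h j * h j) / cosh (X * h j)).
    - intros j; specialize (hpos j).
      assert (Hs : 0 < sinh (X * h j)) by (apply sinh_pos; nra).
      assert (Hc := cosh_pos (X * h j)); field; lra.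
    - apply is_lim_seq_minus'.
      + apply is_lim_seq_div'; [exact Lcosh | exact Lsinh | lra].
      + replace 0 with (X * (0 * 0) / 1) by field.
        apply is_lim_seq_div'; [ | exact Lcosh | lra].
        apply is_lim_seq_mult'; [exact Lsinh | apply is_lim_seq_mult'; exact hlim]. }
  assert (HE : Series l = cosh X / sinh X - (1 / X - 0)).
  { apply is_lim_seq_unique in HR; apply is_lim_seq_unique in HT'.
    rewrite (Lim_seq_ext _ (fun j => psum (a j) (2 ^ j))) in HR.
    - rewrite HT' in HR; now injection HR.
    - intros j; rewrite (coth_finite j X HX); fold (h j).
      unfold a; ring. }
  (* [Series] is total, so the value found for [Series l] does not give convergence; the domination,
     passed to the limit, does. *)
  assert (Hl : ex_series l).
  { apply ex_series_nonneg_le with (2 := exC); intros k; split.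
    - specialize (Hk k); unfold l; apply Rdiv_le_0_compat; [lra | apply Rmult_lt_0_compat; nra].
    - assert (H := is_lim_seq_abs _ _ (Hlim k)).
      apply Rle_trans with (Rabs (l k)); [apply Rle_abs|].
      apply (is_lim_seq_le_loc (fun j => Rabs (a j k)) (fun _ => C * / INR (S k) ^ 2)
               (Rabs (l k)) (C * / INR (S k) ^ 2)); [ | exact H | apply is_lim_seq_const].
      exists k; intros n Hn; apply Hbound.
      apply Nat.le_lt_trans with n; [exact Hn | apply Nat.pow_gt_lin_r; lia]. }
  apply (is_series_ext (fun k => scal PI (l k))).
  - intros k; specialize (Hk k).
    change (PI * (2 * x / (PI * (x ^ 2 + INR (S k) ^ 2))) = 2 * x / (x ^ 2 + INR (S k) ^ 2)).
    field; repeat split; apply Rgt_not_eq; nra.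
  - replace (PI * (cosh X / sinh X) - 1 / x) with (scal PI (Series l)).
    + apply (is_series_scal_l PI l), Series_correct, Hl.
    + rewrite HE; change (PI * (cosh X / sinh X - (1 / X - 0)) = PI * (cosh X / sinh X) - 1 / x).
      replace (1 / X) with (1 / (PI * x)) by reflexivity.
      assert (0 < sinh X) by now apply sinh_pos.
      field; lra.
Qed.

(** * Values of zeta *)

Definition zeta (s : nat) : R := Series (fun n => / INR (S n) ^ s).

Lemma is_series_zeta (s : nat) : (2 <= s)%nat ->
  is_series (fun n => / INR (S n) ^ s) (zeta s).
Proof.
  intros Hs; apply Series_correct.
  apply ex_series_nonneg_le with (2 := ex_series_inv_sqr); intros n.
  assert (H := INR_S_ge_1 n); split.
  - left; apply Rinv_0_lt_compat, pow_lt; lra.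
  - apply Rinv_le_contravar; [apply pow_lt; lra | now apply Rle_pow].
Qed.

(** The quantity compared is the sum of [1 / (x^2 + n^2)]. Three terms of the geometric expansion in
    [x^2 / n^2] leave the remainder [- x^6 / (n^6 (x^2 + n^2))], at most [x^6 / n^8] in absolute
    value. *)
Lemma lattice_row_expansion (x : R) : 0 < x ->
  Rabs ((PI * (cosh (PI * x) / sinh (PI * x)) - 1 / x) / (2 * x)
        - (zeta 2 - x ^ 2 * zeta 4 + x ^ 4 * zeta 6)) <= x ^ 6 * zeta 8.
Proof.
  intros Hx.
  set (q := (PI * (cosh (PI * x) / sinh (PI * x)) - 1 / x) / (2 * x)).
  assert (Hq : is_series (fun n => / (x ^ 2 + INR (S n) ^ 2)) q).
  { assert (H := is_series_scal_l (/ (2 * x)) _ _ (coth_series x Hx)).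
    apply (is_series_ext _ (fun n => / (x ^ 2 + INR (S n) ^ 2))) in H.
    - replace q with (scal (/ (2 * x)) (PI * (cosh (PI * x) / sinh (PI * x)) - 1 / x));
        [exact H | apply Rmult_comm].
    - intros n; assert (Hn := INR_S_ge_1 n).
      change (/ (2 * x) * (2 * x / (x ^ 2 + INR (S n) ^ 2)) = / (x ^ 2 + INR (S n) ^ 2)).
      field; split; apply Rgt_not_eq; nra. }
  assert (H2 := is_series_zeta 2 ltac:(lia)).
  assert (H4 := is_series_scal_l (x ^ 2) _ _ (is_series_zeta 4 ltac:(lia))).
  assert (H6 := is_series_scal_l (x ^ 4) _ _ (is_series_zeta 6 ltac:(lia))).
  assert (H8 := is_series_scal_l (x ^ 6) _ _ (is_series_zeta 8 ltac:(lia))).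
  assert (HR := is_series_minus _ _ _ _ Hq
    (is_series_plus _ _ _ _ (is_series_minus _ _ _ _ H2 H4) H6)).
  set (d := fun n : nat => x ^ 6 * / (INR (S n) ^ 6 * (x ^ 2 + INR (S n) ^ 2))).
  apply (is_series_ext _ (fun n => - d n)) in HR.
  2: { intros n; assert (Hn := INR_S_ge_1 n); unfold d.
       change (/ (x ^ 2 + INR (S n) ^ 2) - (/ INR (S n) ^ 2 - x ^ 2 * / INR (S n) ^ 4
         + x ^ 4 * / INR (S n) ^ 6) = - (x ^ 6 * / (INR (S n) ^ 6 * (x ^ 2 + INR (S n) ^ 2)))).
       field; split; apply Rgt_not_eq; nra. }
  change (is_series (fun n => - d n) (q - (zeta 2 - x ^ 2 * zeta 4 + x ^ 4 * zeta 6))) in HR.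
  change (is_series (fun n => x ^ 6 * / INR (S n) ^ 8) (x ^ 6 * zeta 8)) in H8.
  assert (Hd : forall n, 0 <= d n <= x ^ 6 * / INR (S n) ^ 8).
  { intros n; assert (Hn := INR_S_ge_1 n); unfold d.
    assert (H1 : 0 < INR (S n) ^ 8) by (apply pow_lt; lra).
    assert (H0 : 0 < x ^ 6) by (apply pow_lt; lra).
    assert (H3 : INR (S n) ^ 8 <= INR (S n) ^ 6 * (x ^ 2 + INR (S n) ^ 2)).
    { replace (INR (S n) ^ 8) with (INR (S n) ^ 6 * INR (S n) ^ 2) by ring.
      apply Rmult_le_compat_l; [apply pow_le; lra | nra]. }
    split.
    - apply Rmult_le_pos; [lra | left; apply Rinv_0_lt_compat; lra].
    - apply Rmult_le_compat_l; [lra | apply Rinv_le_contravar; lra]. }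
  apply Rabs_le; split.
  - apply (is_series_le (fun n => - (x ^ 6 * / INR (S n) ^ 8)) (fun n => - d n)).
    + intros n; generalize (Hd n); lra.
    + apply (is_series_opp _ _ H8).
    + exact HR.
  - apply (is_series_le (fun n => - d n) (fun n => x ^ 6 * / INR (S n) ^ 8)).
    + intros n; generalize (Hd n); lra.
    + exact HR.
    + exact H8.
Qed.

(** * Expansion of the hyperbolic cotangent at 0, and comparison of coefficients *)

Lemma exp_taylor (n : nat) (u : R) : Rabs u <= 1 ->
  Rabs (exp u - psum (fun k => u ^ k / INR (Factorial.fact k)) n) <= Rabs u ^ n * exp 1.
Proof.
  intros Hu.
  assert (E : forall v, is_series (fun k => v ^ k / INR (Factorial.fact k)) (exp v)).
  { intros v; apply is_series_ext with (2 := is_exp_Reals v); intros k.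
    rewrite pow_n_pow; reflexivity. }
  assert (Ht := is_series_tail _ _ n (E u)).
  assert (H1 := is_series_scal_l (Rabs u ^ n) _ _ (E 1)).
  change (is_series (fun k => Rabs u ^ n * (1 ^ k / INR (Factorial.fact k)))
    (Rabs u ^ n * exp 1)) in H1.
  assert (Hb : forall k, Rabs (u ^ (n + k) / INR (Factorial.fact (n + k)))
                 <= Rabs u ^ n * (1 ^ k / INR (Factorial.fact k))).
  { intros k.
    assert (F1 := INR_fact_lt_0 k); assert (F2 := INR_fact_lt_0 (n + k)).
    assert (F3 : INR (Factorial.fact k) <= INR (Factorial.fact (n + k)))
      by (apply le_INR, Factorial.fact_le; lia).
    unfold Rdiv; rewrite Rabs_mult, <- RPow_abs, Rabs_inv, (Rabs_pos_eq (INR _)),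
      pow1, pow_add by lra.
    assert (Hk : Rabs u ^ k <= 1)
      by (rewrite <- (pow1 k); apply pow_incr; split; [apply Rabs_pos | exact Hu]).
    assert (Hn := pow_le _ n (Rabs_pos u)); assert (Hk0 := pow_le _ k (Rabs_pos u)).
    rewrite Rmult_assoc; apply Rmult_le_compat_l; [exact Hn|].
    apply Rmult_le_compat; [exact Hk0 | left; now apply Rinv_0_lt_compat | exact Hk |].
    now apply Rinv_le_contravar. }
  apply Rabs_le; split.
  - apply (is_series_le (fun k => - (Rabs u ^ n * (1 ^ k / INR (Factorial.fact k))))
      (fun k => u ^ (n + k) / INR (Factorial.fact (n + k)))).
    + intros k; specialize (Hb k); apply Rabs_le_between in Hb; lra.
    + apply (is_series_opp _ _ H1).
    + exact Ht.
  - apply (is_series_le (fun k => u ^ (n + k) / INR (Factorial.fact (n + k)))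
      (fun k => Rabs u ^ n * (1 ^ k / INR (Factorial.fact k)))).
    + intros k; specialize (Hb k); apply Rabs_le_between in Hb; lra.
    + exact Ht.
    + exact H1.
Qed.

Lemma exp_taylor_9 (u : R) : Rabs u <= 1 ->
  Rabs (exp u - (1 + u + u^2/2 + u^3/6 + u^4/24 + u^5/120 + u^6/720 + u^7/5040 + u^8/40320))
  <= 3 * Rabs u ^ 9.
Proof.
  intros Hu; assert (H := exp_taylor 9 u Hu).
  assert (He := exp_le_3); assert (Hp := pow_le _ 9 (Rabs_pos u)).
  replace (1 + u + u^2/2 + u^3/6 + u^4/24 + u^5/120 + u^6/720 + u^7/5040 + u^8/40320)
    with (psum (fun k => u ^ k / INR (Factorial.fact k)) 9).
  - nra.
  - assert (F : forall n, INR (Factorial.fact (S n)) = INR (S n) * INR (Factorial.fact n))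
      by (intros n; rewrite <- mult_INR; reflexivity).
    cbn [psum]; rewrite !F; change (INR (Factorial.fact 0)) with 1.
    rewrite !INR_IZR_INZ; simpl Z.of_nat; field.
Qed.

(** The coefficients are [4^k B_(2k) / (2k)!] with Bernoulli numbers. They are verified by
    multiplying out: [u cosh u - P sinh u] has no term below [u^9], and [sinh u >= u] allows the
    division. *)
Lemma coth_expansion (u : R) : 0 < u <= 1 ->
  Rabs (u * (cosh u / sinh u) - (1 + u^2/3 - u^4/45 + 2*u^6/945)) <= 12 * u ^ 8.
Proof.
  intros Hu.
  assert (H1 := exp_taylor_9 u); assert (H2 := exp_taylor_9 (- u)).
  rewrite Rabs_Ropp in H2; rewrite Rabs_pos_eq in H1, H2 by lra.
  specialize (H1 ltac:(lra)); specialize (H2 ltac:(lra)).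
  assert (Hs : u <= sinh u).
  { destruct (MVT_cor2 sinh cosh 0 u) as [c [Hc1 Hc2]]; [lra | |].
    - intros c _; apply derivable_pt_lim_sinh.
    - rewrite sinh_0 in Hc1; generalize (cosh_ge_1 c); nra. }
  assert (HC : Rabs (cosh u - (1 + u^2/2 + u^4/24 + u^6/720 + u^8/40320)) <= 3 * u ^ 9).
  { apply Rabs_le_between in H1; apply Rabs_le_between in H2.
    apply Rabs_le; unfold cosh; lra. }
  assert (HS : Rabs (sinh u - (u + u^3/6 + u^5/120 + u^7/5040)) <= 3 * u ^ 9).
  { apply Rabs_le_between in H1; apply Rabs_le_between in H2.
    apply Rabs_le; unfold sinh; lra. }
  set (rc := cosh u - _) in HC; set (rs := sinh u - _) in HS.
  set (P := 1 + u^2/3 - u^4/45 + 2*u^6/945).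
  assert (H9 : 0 < u ^ 9) by (apply pow_lt; lra).
  assert (Hpow : forall k, 0 < u ^ k <= 1).
  { intros k; split; [apply pow_lt; lra|].
    rewrite <- (pow1 k); apply pow_incr; lra. }
  assert (HP : 0 <= P <= 2).
  { unfold P; generalize (Hpow 2%nat) (Hpow 4%nat) (Hpow 6%nat); lra. }
  (* [T] collects the coefficients of [u^9], [u^11] and [u^13] in the product of the Taylor
     polynomials; all lower ones cancel by the choice of [P]. *)
  set (T := 1/40320 - (1/(3*5040) - 1/(45*120) + 2/(945*6))
             + (1/(45*5040) - 2/(945*120)) * u^2 - 2/(945*5040) * u^4).
  assert (E : u * cosh u - sinh u * P = u * rc - rs * P + u ^ 9 * T).
  { unfold rc, rs, P, T; field. }
  assert (HT : Rabs T <= 1).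
  { unfold T; apply Rabs_le; generalize (Hpow 2%nat) (Hpow 4%nat); lra. }
  assert (HE : Rabs (u * cosh u - sinh u * P) <= 12 * u ^ 9).
  { rewrite E; apply Rabs_le_between in HC, HS, HT.
    apply Rabs_le; split; nra. }
  replace (u * (cosh u / sinh u) - P) with ((u * cosh u - sinh u * P) / sinh u) by (field; lra).
  unfold Rdiv; rewrite Rabs_mult, Rabs_inv, (Rabs_pos_eq (sinh u)) by lra.
  apply (Rmult_le_reg_r (sinh u)); [lra|].
  rewrite Rmult_assoc, Rinv_l, Rmult_1_r by lra.
  apply Rle_trans with (1 := HE).
  replace (12 * u ^ 9) with (12 * u ^ 8 * u) by ring.
  apply Rmult_le_compat_l; [generalize (Hpow 8%nat); lra | exact Hs].
Qed.

Lemma eq_0_of_small (a K d : R) : 0 < d -> (forall x, 0 < x < d -> Rabs a <= K * x) -> a = 0.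
Proof.
  intros Hd H.
  destruct (Req_dec a 0) as [|Ha]; [assumption|exfalso].
  apply Rabs_pos_lt in Ha.
  assert (HK : 0 < K) by (specialize (H (d / 2)); nra).
  set (x := Rmin (d / 2) (Rabs a / (2 * K))).
  assert (Hx : 0 < x < d).
  { unfold x; split.
    - apply Rmin_glb_lt; [lra | apply Rdiv_lt_0_compat; lra].
    - apply Rle_lt_trans with (1 := Rmin_l _ _); lra. }
  specialize (H x Hx).
  assert (x <= Rabs a / (2 * K)) by apply Rmin_r.
  assert (K * (Rabs a / (2 * K)) = Rabs a / 2) by (field; lra).
  nra.
Qed.

(** Uniqueness of an asymptotic expansion: letting [x] tend to 0 kills [a]; dividing by [x^2], and
    then by [x^4], does the same for [b] and [c]. *)
Lemma even_poly_coeffs_0 (a b c K d : R) : 0 < d <= 1 ->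
  (forall x, 0 < x < d -> Rabs (a - b * x ^ 2 + c * x ^ 4) <= K * x ^ 6) ->
  a = 0 /\ b = 0 /\ c = 0.
Proof.
  intros Hd H.
  assert (Hb : forall t e x, 0 < x < d -> 0 <= e <= x -> Rabs (t * e) <= Rabs t * x).
  { intros t e x Hx He; rewrite Rabs_mult, (Rabs_pos_eq e) by lra.
    apply Rmult_le_compat_l; [apply Rabs_pos | lra]. }
  assert (Hpow : forall k x, 0 < x < d -> 0 <= x ^ S k <= x).
  { intros k x Hx; split; [apply pow_le; lra|].
    assert (H1 : x ^ k <= 1 ^ k) by (apply pow_incr; lra).
    rewrite pow1 in H1; assert (H0 := pow_le x k); simpl; nra. }
  assert (Ha : a = 0).
  { apply (eq_0_of_small a (Rabs b + Rabs c + Rabs K) d); [lra|].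
    intros x Hx; specialize (H x Hx).
    assert (B1 := Hb b _ x Hx (Hpow 1%nat x Hx)).
    assert (B2 := Hb c _ x Hx (Hpow 3%nat x Hx)).
    assert (B3 := Hb K _ x Hx (Hpow 5%nat x Hx)).
    apply Rabs_le_between in B1, B2, B3, H; apply Rabs_le; lra. }
  subst a.
  assert (Hb0 : b = 0).
  { apply (eq_0_of_small b (Rabs c + Rabs K) d); [lra|].
    intros x Hx; specialize (H x Hx).
    assert (H' : Rabs (b - c * x ^ 2) <= K * x ^ 4).
    { apply (Rmult_le_reg_l (x ^ 2)); [apply pow_lt; lra|].
      rewrite <- (Rabs_pos_eq (x ^ 2)) at 1 by (apply pow_le; lra).
      rewrite <- Rabs_mult, <- Rabs_Ropp.
      replace (- (x ^ 2 * (b - c * x ^ 2))) with (0 - b * x ^ 2 + c * x ^ 4) by ring.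
      replace (x ^ 2 * (K * x ^ 4)) with (K * x ^ 6) by ring; exact H. }
    assert (B2 := Hb c _ x Hx (Hpow 1%nat x Hx)).
    assert (B3 := Hb K _ x Hx (Hpow 3%nat x Hx)).
    apply Rabs_le_between in B2, B3, H'; apply Rabs_le; lra. }
  subst b; repeat split.
  apply (eq_0_of_small c (Rabs K) d); [lra|].
  intros x Hx; specialize (H x Hx).
  assert (H' : Rabs c <= K * x ^ 2).
  { apply (Rmult_le_reg_l (x ^ 4)); [apply pow_lt; lra|].
    rewrite <- (Rabs_pos_eq (x ^ 4)) at 1 by (apply pow_le; lra).
    rewrite <- Rabs_mult.
    replace (x ^ 4 * c) with (0 - 0 * x ^ 2 + c * x ^ 4) by ring.
    replace (x ^ 4 * (K * x ^ 2)) with (K * x ^ 6) by ring; exact H. }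
  assert (B3 := Hb K _ x Hx (Hpow 1%nat x Hx)).
  apply Rabs_le_between in B3; lra.
Qed.

Lemma zeta_values : zeta 2 = PI ^ 2 / 6 /\ zeta 4 = PI ^ 4 / 90 /\ zeta 6 = PI ^ 6 / 945.
Proof.
  assert (Hpi := PI_RGT_0).
  destruct (even_poly_coeffs_0 (zeta 2 - PI ^ 2 / 6) (zeta 4 - PI ^ 4 / 90) (zeta 6 - PI ^ 6 / 945)
    (* The error of [coth_expansion] at [u = PI x], divided by [2 x^2], is [6 PI^8 x^6]; the other
       expansion contributes [zeta 8]. The bound [/ PI] ensures [u <= 1]. *)
    (zeta 8 + 6 * PI ^ 8) (Rmin 1 (/ PI))) as [H2 [H4 H6]]; [ | | lra].
  - split; [apply Rmin_glb_lt; [lra | now apply Rinv_0_lt_compat] | apply Rmin_l].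
  - intros x [Hx0 Hx1].
    assert (Hx2 : PI * x <= 1).
    { replace 1 with (PI * / PI) by (field; lra).
      apply Rmult_le_compat_l; [lra|].
      left; apply Rlt_le_trans with (1 := Hx1), Rmin_r. }
    assert (Hpx : 0 < PI * x) by nra.
    assert (HA := lattice_row_expansion x Hx0).
    assert (HB := coth_expansion (PI * x) (conj Hpx Hx2)).
    set (w := cosh (PI * x) / sinh (PI * x)) in *.
    set (q := (PI * w - 1 / x) / (2 * x)) in *.
    assert (HB' : Rabs (q - (PI ^ 2 / 6 - PI ^ 4 / 90 * x ^ 2 + PI ^ 6 / 945 * x ^ 4))
      <= 6 * PI ^ 8 * x ^ 6).
    { apply (Rmult_le_reg_l (2 * x ^ 2)); [simpl; nra|].
      rewrite <- (Rabs_pos_eq (2 * x ^ 2)) at 1 by (simpl; nra).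
      rewrite <- Rabs_mult.
      replace (2 * x ^ 2 * (6 * PI ^ 8 * x ^ 6)) with (12 * (PI * x) ^ 8) by ring.
      replace (2 * x ^ 2 * (q - (PI ^ 2 / 6 - PI ^ 4 / 90 * x ^ 2 + PI ^ 6 / 945 * x ^ 4)))
        with (PI * x * w - (1 + (PI * x)^2/3 - (PI * x)^4/45 + 2*(PI * x)^6/945))
        by (unfold q; field; lra).
      exact HB. }
    apply Rabs_le_between in HA, HB'; apply Rabs_le; lra.
Qed.

(** * Reciprocity of the Lambert series *)

Definition bose (x : R) : R := / (exp (2 * PI * x) - 1).

Definition lambert (s : nat) (y : R) : R :=
  Series (fun m => bose (INR (S m) * y) / INR (S m) ^ s).

Lemma bose_bound (x : R) : 0 < x -> 0 <= bose x <= / (2 * PI * x).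
Proof.
  intros Hx; assert (Hpi := PI_RGT_0).
  assert (H : 0 < 2 * PI * x) by nra.
  assert (He := exp_ineq1 _ (Rgt_not_eq _ _ H)); unfold bose; split.
  - left; apply Rinv_0_lt_compat; lra.
  - apply Rinv_le_contravar; lra.
Qed.

Lemma coth_bose (x : R) : 0 < x ->
  PI * (cosh (PI * x) / sinh (PI * x)) = PI + 2 * PI * bose x.
Proof.
  intros Hx; assert (Hpi := PI_RGT_0); assert (Hpx : 0 < PI * x) by nra.
  assert (Hs := sinh_pos _ Hpx).
  assert (He := exp_ineq1 (2 * PI * x) ltac:(nra)).
  assert (E1 : exp (2 * PI * x) = exp (PI * x) * exp (PI * x))
    by (rewrite <- exp_plus; f_equal; ring).
  assert (E2 : exp (- (PI * x)) = / exp (PI * x)) by apply exp_Ropp.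
  assert (Hp := exp_pos (PI * x)).
  unfold bose, cosh, sinh in *; rewrite E2 in *; rewrite E1 in *.
  assert (H1 := exp_ineq1 (PI * x) ltac:(lra)).
  field; repeat split; apply Rgt_not_eq; nra.
Qed.

Lemma is_series_lambert (s : nat) (y : R) : (1 <= s)%nat -> 0 < y ->
  is_series (fun m => bose (INR (S m) * y) / INR (S m) ^ s) (lambert s y).
Proof.
  intros Hs Hy; apply Series_correct; assert (Hpi := PI_RGT_0).
  apply ex_series_nonneg_le with (fun m => / (2 * PI * y) * / INR (S m) ^ 2).
  - intros m; assert (Hm := INR_S_ge_1 m).
    assert (Hb := bose_bound (INR (S m) * y) ltac:(nra)).
    assert (Hp : INR (S m) <= INR (S m) ^ s).
    { rewrite <- (pow_1 (INR (S m))) at 1; apply Rle_pow; [exact Hm | exact Hs]. }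
    split.
    + apply Rdiv_le_0_compat; lra.
    + replace (/ (2 * PI * y) * / INR (S m) ^ 2) with (/ (2 * PI * (INR (S m) * y)) * / INR (S m))
        by (field; lra).
      apply Rmult_le_compat; [lra | left; apply Rinv_0_lt_compat; lra | lra |].
      apply Rinv_le_contravar; lra.
  - apply (ex_series_scal_l (/ (2 * PI * y)) (fun m => / INR (S m) ^ 2)), ex_series_inv_sqr.
Qed.

(** The term of order [1 / m] is not summable over [m]. An extra factor [m^-p] with [p >= 1] cures
    this in [lattice_sum]; in weight 2 the term must cancel between [y] and [1 / y] before any
    limit. *)
Lemma lattice_row (m : nat) (y : R) : 0 < y ->
  is_series (fun n => / ((INR (S m) * y) ^ 2 + INR (S n) ^ 2))
    (PI / (2 * y) * / INR (S m) + PI / y * (bose (INR (S m) * y) / INR (S m))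
     - / (2 * y ^ 2) * / INR (S m) ^ 2).
Proof.
  intros Hy; assert (Hm := INR_S_ge_1 m).
  set (x := INR (S m) * y); assert (Hx : 0 < x) by (unfold x; nra).
  assert (H := is_series_scal_l (/ (2 * x)) _ _ (coth_series x Hx)).
  rewrite coth_bose in H by exact Hx.
  apply (is_series_ext _ (fun n => / (x ^ 2 + INR (S n) ^ 2))) in H.
  - match goal with |- is_series _ ?v => replace v with
      (scal (/ (2 * x)) (PI + 2 * PI * bose x - 1 / x)); [exact H|] end.
    change (/ (2 * x) * (PI + 2 * PI * bose x - 1 / x) = PI / (2 * y) * / INR (S m)
      + PI / y * (bose x / INR (S m)) - / (2 * y ^ 2) * / INR (S m) ^ 2).
    unfold x at 1 3; field; lra.
  - intros n; assert (Hn := INR_S_ge_1 n).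
    change (/ (2 * x) * (2 * x / (x ^ 2 + INR (S n) ^ 2)) = / (x ^ 2 + INR (S n) ^ 2)).
    field; split; apply Rgt_not_eq; nra.
Qed.

Definition lattice_term (p : nat) (y : R) (m n : nat) : R :=
  / (INR (S m) ^ p * ((INR (S m) * y) ^ 2 + INR (S n) ^ 2)).

Lemma lattice_term_nonneg (p : nat) (y : R) (m n : nat) : 0 <= lattice_term p y m n.
Proof.
  unfold lattice_term; left; apply Rinv_0_lt_compat, Rmult_lt_0_compat.
  - apply pow_lt; generalize (INR_S_ge_1 m); lra.
  - generalize (INR_S_ge_1 n); intros; nra.
Qed.

Lemma lattice_sum (p : nat) (y : R) : (1 <= p)%nat -> 0 < y ->
  exists r, (forall m, is_series (lattice_term p y m) (r m)) /\
    is_series r (PI / (2 * y) * (zeta (S p) + 2 * lambert (S p) y)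
                 - zeta (S (S p)) / (2 * y ^ 2)).
Proof.
  intros Hp Hy.
  exists (fun m => PI / (2 * y) * / INR (S m) ^ S p
     + PI / y * (bose (INR (S m) * y) / INR (S m) ^ S p)
     - / (2 * y ^ 2) * / INR (S m) ^ S (S p)).
  split.
  - intros m; assert (Hm := INR_S_ge_1 m).
    assert (Hmp : 0 < INR (S m) ^ p) by (apply pow_lt; lra).
    assert (H := is_series_scal_l (/ INR (S m) ^ p) _ _ (lattice_row m y Hy)).
    match type of H with is_series _ ?v => match goal with |- is_series _ ?w =>
      replace w with v end end.
    + apply is_series_ext with (2 := H); intros n; unfold lattice_term.
      symmetry; apply Rinv_mult.
    + match goal with |- scal ?a ?b = ?c => change (a * b = c :> R) end.
      rewrite <- (tech_pow_Rmult (INR (S m)) (S p)), <- (tech_pow_Rmult (INR (S m)) p).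
      field; split; lra.
  - assert (H1 := is_series_scal_l (PI / (2 * y)) _ _ (is_series_zeta (S p) ltac:(lia))).
    assert (H2 := is_series_scal_l (PI / y) _ _ (is_series_lambert (S p) y ltac:(lia) Hy)).
    assert (H3 := is_series_scal_l (/ (2 * y ^ 2)) _ _ (is_series_zeta (S (S p)) ltac:(lia))).
    assert (H := is_series_minus _ _ _ _ (is_series_plus _ _ _ _ H1 H2) H3).
    match type of H with is_series _ ?v => match goal with |- is_series _ ?w =>
      replace w with v end end.
    + exact H.
    + change (PI / (2 * y) * zeta (S p) + PI / y * lambert (S p) y - / (2 * y ^ 2) * zeta (S (S p))
       = PI / (2 * y) * (zeta (S p) + 2 * lambert (S p) y) - zeta (S (S p)) / (2 * y ^ 2)).
      field; lra.
Qed.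

(** At [1 / y] with the indices exchanged, the lattice term has the same quadratic form up to the
    factor [y^2]. The weight [e] is left free so that the combination splits into products of powers
    of [m] and [n], whose column sums [k] are explicit zeta values. *)
Lemma lattice_reciprocity (p : nat) (y e L : R) (k : nat -> R) : (1 <= p)%nat -> 0 < y ->
  (forall n, is_series (fun m => lattice_term p y m n + e * lattice_term p (/ y) n m) (k n)) ->
  is_series k L ->
  (PI / (2 * y) * (zeta (S p) + 2 * lambert (S p) y) - zeta (S (S p)) / (2 * y ^ 2))
  + e * (PI * y / 2 * (zeta (S p) + 2 * lambert (S p) (/ y)) - zeta (S (S p)) * y ^ 2 / 2) = L.
Proof.
  intros Hp Hy Hk HL.
  assert (Hy' : 0 < / y) by now apply Rinv_0_lt_compat.
  destruct (lattice_sum p y Hp Hy) as [r [Hr Hrs]].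
  destruct (lattice_sum p (/ y) Hp Hy') as [r' [Hr' Hrs']].
  assert (Hc := fubini_nonneg _ _ _ (lattice_term_nonneg p y) Hr Hrs).
  assert (Hcol : forall n, is_series (fun m => lattice_term p y m n)
                             (Series (fun m => lattice_term p y m n))).
  { intros n; apply Series_correct, (fubini_nonneg_ex (lattice_term p y) r).
    - apply lattice_term_nonneg.
    - exact Hr.
    - eexists; exact Hrs. }
  assert (H := is_series_plus _ _ _ _ Hc (is_series_scal_l e _ _ Hrs')).
  (* Only the sum at [y] is transposed: its column [n] meets row [n] of the sum at [1 / y]. Since
     [e] may be negative, Fubini is never applied to the combination. *)
  assert (Hk' : forall n, Series (fun m => lattice_term p y m n) + e * r' n = k n).
  { intros n; rewrite <- (is_series_unique _ _ (Hk n)); symmetry; apply is_series_unique.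
    apply (is_series_plus _ _ _ _ (Hcol n) (is_series_scal_l e _ _ (Hr' n))). }
  apply (is_series_ext _ k _ Hk') in H.
  apply is_series_unique in HL; apply is_series_unique in H; rewrite <- HL, H.
  match goal with |- _ = plus ?a (scal ?b ?c) => change (plus a (scal b c)) with (a + b * c) end.
  replace (PI / (2 * / y)) with (PI * y / 2) by (field; lra).
  replace (zeta (S (S p)) / (2 * (/ y) ^ 2)) with (zeta (S (S p)) * y ^ 2 / 2) by (field; lra).
  reflexivity.
Qed.

(** With [D = m^2 y^2 + n^2]: [1 / (m^2 D) + y^2 / (n^2 D) = 1 / (m^2 n^2)]. *)
Lemma lambert_3_reciprocity (y : R) : 0 < y ->
  2 * lambert 3 y + zeta 3 + y ^ 2 * (2 * lambert 3 (/ y) + zeta 3)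
  = zeta 4 / PI * (/ y + y ^ 3) + 2 * zeta 2 ^ 2 / PI * y.
Proof.
  intros Hy; assert (Hpi := PI_RGT_0).
  assert (H := lattice_reciprocity 2 y 1 (zeta 2 * zeta 2)
    (fun n => zeta 2 * / INR (S n) ^ 2) ltac:(lia) Hy).
  assert (E : PI / (2 * y) * (zeta 3 + 2 * lambert 3 y) - zeta 4 / (2 * y ^ 2)
    + 1 * (PI * y / 2 * (zeta 3 + 2 * lambert 3 (/ y)) - zeta 4 * y ^ 2 / 2) = zeta 2 * zeta 2).
  { apply H.
    - intros n; assert (Hn := INR_S_ge_1 n).
      assert (HZ := is_series_scal_r (/ INR (S n) ^ 2) _ _ (is_series_zeta 2 ltac:(lia))).
      apply is_series_ext with (2 := HZ); intros m; assert (Hm := INR_S_ge_1 m).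
      unfold lattice_term.
      change (/ INR (S m) ^ 2 * / INR (S n) ^ 2
        = / (INR (S m) ^ 2 * ((INR (S m) * y) ^ 2 + INR (S n) ^ 2))
          + 1 * / (INR (S n) ^ 2 * ((INR (S n) * / y) ^ 2 + INR (S m) ^ 2))).
      field; repeat split; apply Rgt_not_eq; nra.
    - apply (is_series_scal_l (zeta 2) _ _ (is_series_zeta 2 ltac:(lia))). }
  apply (Rmult_eq_reg_l (PI / (2 * y))); [|apply Rgt_not_eq, Rdiv_lt_0_compat; lra].
  apply (Rplus_eq_reg_r (- (zeta 4 / (2 * y ^ 2)) - zeta 4 * y ^ 2 / 2)).
  transitivity (zeta 2 * zeta 2); [rewrite <- E |]; field; lra.
Qed.

(** With [D = m^2 y^2 + n^2], the combination [1 / (m^4 D) - y^4 / (n^4 D)] has numerator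
    [n^4 - m^4 y^4], divisible by [D]; hence the weight [- y ^ 2]. *)
Lemma lambert_5_reciprocity (y : R) : 0 < y ->
  2 * lambert 5 y + zeta 5 - y ^ 4 * (2 * lambert 5 (/ y) + zeta 5)
  = zeta 6 / PI * (/ y - y ^ 5) + 2 * zeta 2 * zeta 4 / PI * (y - y ^ 3).
Proof.
  intros Hy; assert (Hpi := PI_RGT_0).
  assert (H := lattice_reciprocity 4 y (- y ^ 2) (zeta 4 * zeta 2 - y ^ 2 * zeta 2 * zeta 4)
    (fun n => zeta 4 * / INR (S n) ^ 2 - y ^ 2 * zeta 2 * / INR (S n) ^ 4) ltac:(lia) Hy).
  assert (E : PI / (2 * y) * (zeta 5 + 2 * lambert 5 y) - zeta 6 / (2 * y ^ 2)
    + - y ^ 2 * (PI * y / 2 * (zeta 5 + 2 * lambert 5 (/ y)) - zeta 6 * y ^ 2 / 2)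
    = zeta 4 * zeta 2 - y ^ 2 * zeta 2 * zeta 4).
  { apply H.
    - intros n; assert (Hn := INR_S_ge_1 n).
      assert (HZ4 := is_series_scal_r (/ INR (S n) ^ 2) _ _ (is_series_zeta 4 ltac:(lia))).
      assert (HZ2 := is_series_scal_r (/ INR (S n) ^ 4) _ _
        (is_series_scal_l (y ^ 2) _ _ (is_series_zeta 2 ltac:(lia)))).
      apply is_series_ext with (2 := is_series_minus _ _ _ _ HZ4 HZ2).
      intros m; assert (Hm := INR_S_ge_1 m).
      unfold lattice_term.
      change (/ INR (S m) ^ 4 * / INR (S n) ^ 2 - y ^ 2 * / INR (S m) ^ 2 * / INR (S n) ^ 4
        = / (INR (S m) ^ 4 * ((INR (S m) * y) ^ 2 + INR (S n) ^ 2))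
          + - y ^ 2 * / (INR (S n) ^ 4 * ((INR (S n) * / y) ^ 2 + INR (S m) ^ 2))).
      field; repeat split; apply Rgt_not_eq; nra.
    - apply (is_series_minus _ _ _ _
        (is_series_scal_l (zeta 4) _ _ (is_series_zeta 2 ltac:(lia)))
        (is_series_scal_l (y ^ 2 * zeta 2) _ _ (is_series_zeta 4 ltac:(lia)))). }
  apply (Rmult_eq_reg_l (PI / (2 * y))); [|apply Rgt_not_eq, Rdiv_lt_0_compat; lra].
  apply (Rplus_eq_reg_r (- (zeta 6 / (2 * y ^ 2)) + zeta 6 * y ^ 4 / 2)).
  transitivity (zeta 4 * zeta 2 - y ^ 2 * zeta 2 * zeta 4); [rewrite <- E |]; field; lra.
Qed.

(** * Weight 2: the tails of the square truncation *)

Lemma is_derive_atan_scal (a v : R) : is_derive (fun t => atan (a * t)) v (a / (1 + (a * v) ^ 2)).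
Proof.
  auto_derive; auto; unfold Rsqr; field; apply Rgt_not_eq; nra.
Qed.

Lemma atan_diff_bounds (a u v : R) : 0 <= a -> 0 <= u < v ->
  (v - u) * (a / (1 + (a * v) ^ 2)) <= atan (a * v) - atan (a * u)
  <= (v - u) * (a / (1 + (a * u) ^ 2)).
Proof.
  intros Ha Huv.
  destruct (MVT_cor2 (fun t => atan (a * t)) (fun t => a / (1 + (a * t) ^ 2)) u v) as [c [Hc1 Hc2]].
  - lra.
  - intros c _; apply is_derive_Reals, is_derive_atan_scal.
  - assert (Hu : 0 <= a * u) by nra.
    assert (Huc : a * u <= a * c <= a * v) by nra.
    rewrite Hc1, (Rmult_comm _ (v - u)).
    split; apply Rmult_le_compat_l; try lra; apply Rmult_le_compat_l; try lra;
      apply Rinv_le_contravar; nra.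
Qed.

(** The primitive [- atan (a / t)] of [a / (a^2 + t^2)] is the one that vanishes at infinity, so
    that the sums over a tail telescope to a single arctangent. *)
Lemma inv_diff_bounds (a : R) (u v : R) : 0 <= a -> 0 < u < v ->
  (v - u) * (a / (a ^ 2 + v ^ 2)) <= atan (a / u) - atan (a / v)
  <= (v - u) * (a / (a ^ 2 + u ^ 2)).
Proof.
  intros Ha Huv.
  destruct (MVT_cor2 (fun t => - atan (a / t)) (fun t => a / (a ^ 2 + t ^ 2)) u v) as [c [Hc1 Hc2]].
  - lra.
  - intros c Hc; apply is_derive_Reals; auto_derive; [lra|].
    unfold Rsqr; field; split; apply Rgt_not_eq; nra.
  - replace (atan (a / u) - atan (a / v)) with (- atan (a / v) - - atan (a / u)) by ring.
    rewrite Hc1, (Rmult_comm _ (v - u)).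
    split; apply Rmult_le_compat_l; try lra; apply Rmult_le_compat_l; try lra;
      apply Rinv_le_contravar; nra.
Qed.

Lemma lattice_tail_bounds (a t : R) (N : nat) : 0 < a -> (1 <= N)%nat ->
  is_series (fun k => a / (a ^ 2 + INR (S (N + k)) ^ 2)) t ->
  atan (a / INR (S N)) <= t <= atan (a / INR N).
Proof.
  intros Ha HN Ht.
  assert (Hat : forall M, is_series (fun k => atan (a / INR (M + k)) - atan (a / INR (M + S k)))
                  (atan (a / INR (M + 0)))).
  { intros M; apply (is_series_telescope (fun k => atan (a / INR (M + k)))).
    rewrite <- atan_0; apply (is_lim_seq_continuous atan).
    - apply derivable_continuous_pt, derivable_pt_atan.
    - replace 0 with (a * 0) by ring.
      apply (is_lim_seq_mult' (fun _ => a) (fun k => / INR (M + k)) a 0); [apply is_lim_seq_const|].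
      apply (is_lim_seq_incr_1 (fun k => / INR (M + k))).
      apply is_lim_seq_ext with (fun k => / INR (S (k + M)));
        [intros k; do 2 f_equal; lia|].
      apply (is_lim_seq_incr_n (fun k => / INR (S k)) M), is_lim_seq_inv_S. }
  assert (Hb : forall n, (1 <= n)%nat ->
     a / (a ^ 2 + INR (S n) ^ 2) <= atan (a / INR n) - atan (a / INR (S n))
     <= a / (a ^ 2 + INR n ^ 2)).
  { intros n Hn; assert (H1 : 1 <= INR n) by (change 1 with (INR 1); now apply le_INR).
    assert (H := inv_diff_bounds a (INR n) (INR (S n)) ltac:(lra) ltac:(rewrite S_INR; lra)).
    replace (INR (S n) - INR n) with 1 in H by (rewrite S_INR; ring); lra. }
  split.
  - replace (INR (S N)) with (INR (S N + 0)) by (f_equal; lia).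
    apply (is_series_le _ _ _ _) with (2 := Hat (S N)) (3 := Ht); intros k.
    replace (S N + S k)%nat with (S (S N + k)) by lia; apply Hb; lia.
  - replace (INR N) with (INR (N + 0)) by (f_equal; lia).
    apply (is_series_le _ _ _ _) with (2 := Ht) (3 := Hat N); intros k.
    replace (N + S k)%nat with (S (N + k)) by lia; apply Hb; lia.
Qed.

(* Approximates [sum_(m <= N) sum_(n > N) y / (m^2 y^2 + n^2)] within [y / (N + 1)]. *)
Definition atan_riemann (N : nat) (y : R) : R :=
  psum (fun m => atan (INR (S m) / INR N * y) / INR (S m)) N.

(* [y] times the derivative of [atan_riemann N]: a Riemann sum of [atan y]. *)
Definition atan_riemann_deriv (N : nat) (y : R) : R :=
  psum (fun m => y / INR N / (1 + (y * (INR (S m) / INR N)) ^ 2)) N.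

Lemma is_derive_psum (f f' : nat -> R -> R) (n : nat) (x : R) :
  (forall k, (k < n)%nat -> is_derive (f k) x (f' k x)) ->
  is_derive (fun t => psum (fun k => f k t) n) x (psum (fun k => f' k x) n).
Proof.
  induction n as [|n IH]; intros H; simpl.
  - apply @is_derive_const.
  - apply (is_derive_plus (fun t => psum (fun k => f k t) n) (f n)); auto.
Qed.

Lemma is_derive_atan_riemann (N : nat) (y : R) : (1 <= N)%nat -> 0 < y ->
  is_derive (atan_riemann N) y (atan_riemann_deriv N y / y).
Proof.
  intros HN Hy; assert (H1 : 1 <= INR N) by (change 1 with (INR 1); now apply le_INR).
  replace (atan_riemann_deriv N y / y)
    with (psum (fun m => / INR N / (1 + (y * (INR (S m) / INR N)) ^ 2)) N).
  - apply (is_derive_psum (fun m t => atan (INR (S m) / INR N * t) / INR (S m))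
      (fun m t => / INR N / (1 + (t * (INR (S m) / INR N)) ^ 2))).
    intros m _; assert (Hm := INR_S_ge_1 m).
    generalize dependent (INR (S m)); generalize dependent (INR N); intros b Hb a Ha.
    auto_derive; auto; unfold Rsqr.
    field; repeat split; apply Rgt_not_eq; nra.
  - replace (atan_riemann_deriv N y / y) with (/ y * atan_riemann_deriv N y) by apply Rmult_comm.
    unfold atan_riemann_deriv; rewrite <- psum_scal.
    apply psum_ext; intros m _; field; repeat split; apply Rgt_not_eq; nra.
Qed.

(** This is the right-endpoint sum over [0, 1] of the decreasing function [y / (1 + (y t)^2)], whose
    integral is [atan y]. The left-endpoint sum lies above the integral and exceeds it by
    [g 0 - g N <= y / N]. *)
Lemma atan_riemann_deriv_bounds (N : nat) (y : R) : (1 <= N)%nat -> 0 < y ->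
  atan y - y / INR N <= atan_riemann_deriv N y <= atan y.
Proof.
  intros HN Hy; assert (H1 : 1 <= INR N) by (change 1 with (INR 1); now apply le_INR).
  set (f := fun m : nat => atan (y * (INR m / INR N))).
  assert (Hf : forall m, f (S m) - f m
    <= y / INR N / (1 + (y * (INR m / INR N)) ^ 2) /\
    y / INR N / (1 + (y * (INR (S m) / INR N)) ^ 2) <= f (S m) - f m).
  { intros m; unfold f.
    assert (H := atan_diff_bounds y (INR m / INR N) (INR (S m) / INR N) ltac:(lra)).
    replace (INR (S m) / INR N - INR m / INR N) with (/ INR N) in H by (rewrite S_INR; field; lra).
    unfold Rdiv in *; rewrite <- !Rmult_assoc in H; rewrite !(Rmult_comm y (/ INR N)).
    apply and_comm; rewrite <- !Rmult_assoc.
    apply H; split.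
    - apply Rmult_le_pos; [apply pos_INR | left; apply Rinv_0_lt_compat; lra].
    - apply Rmult_lt_compat_r; [apply Rinv_0_lt_compat; lra | rewrite S_INR; lra]. }
  assert (f0 : f O = 0)
    by (unfold f; simpl (INR 0); unfold Rdiv; rewrite Rmult_0_l, Rmult_0_r; apply atan_0).
  assert (fN : f N = atan y) by (unfold f; f_equal; field; lra).
  assert (T := psum_telescope f N); rewrite f0, fN, Rminus_0_r in T.
  unfold atan_riemann_deriv; split; [|rewrite <- T; apply psum_le; intros m _; apply Hf].
  set (g := fun m => y / INR N / (1 + (y * (INR m / INR N)) ^ 2)).
  assert (T2 := psum_telescope g N).
  assert (g0 : g O = y / INR N) by (unfold g; simpl (INR 0); field; lra).
  assert (gN : 0 <= g N).
  { unfold g; apply Rdiv_le_0_compat; [apply Rdiv_le_0_compat; lra | nra]. }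
  assert (HL : psum (fun m => f (S m) - f m) N <= psum g N)
    by (apply psum_le; intros m _; apply Hf).
  assert (HS : psum (fun m => g (S m)) N = psum g N + psum (fun m => g (S m) - g m) N)
    by (rewrite <- psum_plus; apply psum_ext; intros; ring).
  change (atan y - y / INR N <= psum (fun m => g (S m)) N).
  lra.
Qed.

(** The sums approximate the integral of [atan (y t) / t] over [0, 1], which is not elementary; its
    difference at [y] and [1 / y] is. The derivative of the expression is nearly
    [(atan t + atan (1 / t) - PI / 2) / t = 0], and the expression vanishes at 1. The mean value
    point lies between 1 and [y], whence the minimum in the bound. *)
Lemma atan_riemann_reciprocity (N : nat) (y : R) : (1 <= N)%nat -> 0 < y ->
  Rabs (atan_riemann N y - atan_riemann N (/ y) - PI / 2 * ln y)
  <= (1 + / Rmin 1 y ^ 2) * Rabs (y - 1) * / INR N.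
Proof.
  intros HN Hy; assert (H1 : 1 <= INR N) by (change 1 with (INR 1); now apply le_INR).
  set (F := fun t => atan_riemann N t - atan_riemann N (/ t) - PI / 2 * ln t).
  set (dF := fun t => (atan_riemann_deriv N t + atan_riemann_deriv N (/ t) - PI / 2) / t).
  assert (Hd : forall t, 0 < t -> is_derive F t (dF t)).
  { intros t Ht; assert (Ht' := Rinv_0_lt_compat _ Ht).
    assert (D1 := is_derive_atan_riemann N t HN Ht).
    assert (D2 := is_derive_comp (atan_riemann N) Rinv t _ (- / t ^ 2)
       (is_derive_atan_riemann N (/ t) HN Ht') ltac:(auto_derive; [lra | field; lra])).
    assert (D3 : is_derive (fun t => PI / 2 * ln t) t (PI / 2 * / t)) by (auto_derive; lra).
    evar_last.
    - apply (is_derive_minus _ _ _ _ _ (is_derive_minus _ _ _ _ _ D1 D2) D3).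
    - change (atan_riemann_deriv N t / t - (- / t ^ 2) * (atan_riemann_deriv N (/ t) / / t)
        - PI / 2 * / t
        = dF t).
      unfold dF; field; lra. }
  assert (Hm : 0 < Rmin 1 y) by (apply Rmin_glb_lt; lra).
  destruct (MVT_gen F 1 y dF) as [c [Hc1 Hc2]].
  - intros x Hx; apply Hd; lra.
  - intros x Hx; apply continuity_pt_filterlim, @ex_derive_continuous.
    exists (dF x); apply Hd; lra.
  - assert (F1 : F 1 = 0) by (unfold F; rewrite Rinv_1, ln_1; ring).
    change (Rabs (F y) <= (1 + / Rmin 1 y ^ 2) * Rabs (y - 1) * / INR N).
    replace (F y) with (F y - F 1) by (rewrite F1; ring).
    rewrite Hc2, Rabs_mult.
    replace ((1 + / Rmin 1 y ^ 2) * Rabs (y - 1) * / INR N)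
      with ((1 + / Rmin 1 y ^ 2) * / INR N * Rabs (y - 1)) by ring.
    apply Rmult_le_compat_r; [apply Rabs_pos|].
    assert (Hc : 0 < c) by lra; assert (Hc' := Rinv_0_lt_compat _ Hc).
    assert (B1 := atan_riemann_deriv_bounds N c HN Hc).
    assert (B2 := atan_riemann_deriv_bounds N (/ c) HN Hc').
    rewrite (atan_inv c Hc) in B2.
    assert (Hcm : / c ^ 2 <= / Rmin 1 y ^ 2).
    { apply Rinv_le_contravar; [apply pow_lt; lra | apply pow_incr; lra]. }
    unfold dF, Rdiv at 1; rewrite Rabs_mult, (Rabs_pos_eq (/ c)) by lra.
    apply Rle_trans with ((c / INR N + / c / INR N) * / c).
    + apply Rmult_le_compat_r; [lra|].
      assert (0 <= c / INR N) by (apply Rdiv_le_0_compat; lra).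
      assert (0 <= / c / INR N) by (apply Rdiv_le_0_compat; lra).
      apply Rabs_le; lra.
    + replace ((c / INR N + / c / INR N) * / c) with ((1 + / c ^ 2) * / INR N) by (field; lra).
      apply Rmult_le_compat_r; [left; apply Rinv_0_lt_compat; lra | lra].
Qed.

Lemma lambert_1_reciprocity (y : R) : 0 < y ->
  2 * lambert 1 y - 2 * lambert 1 (/ y) = zeta 2 / PI * (/ y - y) + ln y.
Proof.
  intros Hy; assert (Hpi := PI_RGT_0).
  (* The rows are multiplied by [y]: the harmonic term becomes independent of [y], and the summand
     becomes symmetric under exchanging [m], [n] and inverting [y]. *)
  set (row := fun (y : R) (m : nat) => PI / 2 * / INR (S m)
     + PI * (bose (INR (S m) * y) / INR (S m) ^ 1) - / (2 * y) * / INR (S m) ^ 2).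
  set (u := fun (y : R) (m n : nat) => y / ((INR (S m) * y) ^ 2 + INR (S n) ^ 2)).
  set (T := fun (y : R) (N : nat) => psum (fun m => row y m - psum (u y m) N) N).
  assert (Hrow : forall y m, 0 < y -> is_series (u y m) (row y m)).
  { clear y Hy; intros y m Hy; assert (Hm := INR_S_ge_1 m).
    assert (H := is_series_scal_l y _ _ (lattice_row m y Hy)).
    match type of H with is_series _ ?v => replace (row y m) with v; [exact H|] end.
    match goal with |- scal ?a ?b = ?c => change (a * b = c :> R) end.
    unfold row; field; lra. }
  assert (HTE : forall y, 0 < y -> is_lim_seq (fun N => T y (S N) - atan_riemann (S N) y) 0).
  { clear y Hy; intros y Hy.
    apply is_lim_seq_abs_0.
    apply (is_lim_seq_le_le (fun _ => 0) _ (fun N => y * / INR (S N))).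
    2: apply is_lim_seq_const.
    2: { replace 0 with (y * 0) by ring.
         apply (is_lim_seq_mult' (fun _ => y) (fun N => / INR (S N)) y 0);
           [apply is_lim_seq_const | apply is_lim_seq_inv_S]. }
    intros n; split; [apply Rabs_pos|].
    set (N := S n); assert (HN := INR_S_ge_1 n); fold N in HN.
    set (e := fun m => row y m - psum (u y m) N - atan (INR (S m) / INR N * y) / INR (S m)).
    assert (E : T y N - atan_riemann N y = psum e N).
    { unfold T, atan_riemann, e; now rewrite (psum_minus (fun m => row y m - psum (u y m) N)). }
    (* Multiplied by [m], the tail lies between the arctangents at [a / (N + 1)] and [a / N], which
       differ by at most [a / N^2]; the [N] rows add up to an error of at most [y / N]. *)
    assert (He : forall m, - (y * / INR N ^ 2) <= e m <= 0).
    { intros m; assert (Hm := INR_S_ge_1 m); set (a := INR (S m) * y).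
      assert (Ha : 0 < a) by (unfold a; nra).
      assert (Ht := is_series_scal_l (INR (S m)) _ _ (is_series_tail _ _ N (Hrow y m Hy))).
      apply (is_series_ext _ (fun k => a / (a ^ 2 + INR (S (N + k)) ^ 2))) in Ht.
      2: { intros k; unfold u; fold a.
           match goal with |- scal ?a ?b = ?c => change (a * b = c :> R) end.
           unfold a at 2; assert (Hk := INR_S_ge_1 (N + k)); field; apply Rgt_not_eq; nra. }
      apply lattice_tail_bounds in Ht; [|exact Ha | unfold N; lia].
      assert (Hd := inv_diff_bounds a (INR N) (INR (S N)) ltac:(lra) ltac:(rewrite S_INR; lra)).
      replace (INR (S N) - INR N) with 1 in Hd by (rewrite S_INR; ring).
      assert (Hq : a / (a ^ 2 + INR N ^ 2) <= a * / INR N ^ 2).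
      { apply Rmult_le_compat_l; [lra|]; apply Rinv_le_contravar; nra. }
      set (t := row y m - psum (u y m) N) in *.
      change (scal (INR (S m)) t) with (INR (S m) * t) in Ht.
      replace (a / INR N) with (INR (S m) / INR N * y) in Ht, Hd by (unfold a; field; lra).
      set (b := atan (INR (S m) / INR N * y)) in *.
      assert (Eb : INR (S m) * (b / INR (S m)) = b) by (field; lra).
      assert (Ea : INR (S m) * (y * / INR N ^ 2) = a * / INR N ^ 2) by (unfold a; ring).
      unfold e; fold t b; split; apply (Rmult_le_reg_l (INR (S m))); lra. }
    rewrite E; apply Rabs_le; split.
    - apply Rle_trans with (psum (fun _ => - (y * / INR N ^ 2)) N).
      + rewrite psum_const; right; field; lra.
      + apply psum_le; intros; apply He.
    - apply Rle_trans with (psum (fun _ => 0) N).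
      + apply psum_le; intros; apply He.
      + rewrite psum_const, Rmult_0_r.
        apply Rmult_le_pos; [lra | left; apply Rinv_0_lt_compat; lra]. }
  assert (Hy' := Rinv_0_lt_compat _ Hy).
  assert (HE : is_lim_seq (fun N => atan_riemann (S N) y - atan_riemann (S N) (/ y))
    (PI / 2 * ln y)).
  { apply is_lim_seq_ext with (fun N => PI / 2 * ln y
      + (atan_riemann (S N) y - atan_riemann (S N) (/ y) - PI / 2 * ln y)); [intros; ring|].
    replace (Finite (PI / 2 * ln y)) with (Finite (PI / 2 * ln y + 0)) by (f_equal; ring).
    apply is_lim_seq_plus'; [apply is_lim_seq_const|].
    apply is_lim_seq_abs_0.
    set (K := (1 + / Rmin 1 y ^ 2) * Rabs (y - 1)).
    apply (is_lim_seq_le_le (fun _ => 0) _ (fun N => K * / INR (S N))).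
    - intros N; split; [apply Rabs_pos | apply atan_riemann_reciprocity; [lia | exact Hy]].
    - apply is_lim_seq_const.
    - replace 0 with (K * 0) by ring.
      apply (is_lim_seq_mult' (fun _ => K) (fun N => / INR (S N)) K 0);
        [apply is_lim_seq_const | apply is_lim_seq_inv_S]. }
  assert (HT : is_lim_seq (fun N => T y (S N) - T (/ y) (S N)) (0 - 0 + PI / 2 * ln y)).
  { apply is_lim_seq_ext with (fun N => (T y (S N) - atan_riemann (S N) y)
      - (T (/ y) (S N) - atan_riemann (S N) (/ y))
      + (atan_riemann (S N) y - atan_riemann (S N) (/ y))); [intros; ring|].
    apply is_lim_seq_plus'; [apply is_lim_seq_minus'; now apply HTE | exact HE]. }
  assert (Hsym : forall N, psum (fun m => psum (u y m) N) N = psum (fun m => psum (u (/ y) m) N) N).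
  { intros N; rewrite psum_swap; apply psum_ext; intros n _; apply psum_ext; intros m _.
    assert (Hn := INR_S_ge_1 n); assert (Hm := INR_S_ge_1 m).
    unfold u; field; repeat split; apply Rgt_not_eq; nra. }
  set (W := fun (y : R) N => psum (fun m => bose (INR (S m) * y) / INR (S m) ^ 1) N).
  set (Z := fun N => psum (fun m => / INR (S m) ^ 2) N).
  set (H := fun N => psum (fun m => / INR (S m)) N).
  assert (HTW : forall y N, T y N
    = PI / 2 * H N + PI * W y N - / (2 * y) * Z N - psum (fun m => psum (u y m) N) N).
  { intros z N; unfold T, row, H, W, Z.
    now rewrite !psum_minus, psum_plus, !psum_scal. }
  assert (HWl : forall y, 0 < y -> is_lim_seq (fun N => W y (S N)) (lambert 1 y)).
  { intros z Hz; apply (is_lim_seq_incr_1 (W z)), is_series_psum.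
    apply is_series_lambert; [lia | exact Hz]. }
  assert (HZl : is_lim_seq (fun N => Z (S N)) (zeta 2)).
  { apply (is_lim_seq_incr_1 Z), is_series_psum, is_series_zeta; lia. }
  (* In the difference at [y] and [1 / y] the divergent harmonic sums [H] and the symmetric squares
     cancel, leaving convergent sums only. *)
  assert (HT2 : is_lim_seq (fun N => T y (S N) - T (/ y) (S N))
    (PI * (lambert 1 y - lambert 1 (/ y)) + (y - / y) / 2 * zeta 2)).
  { apply is_lim_seq_ext with (fun N => PI * (W y (S N) - W (/ y) (S N)) + (y - / y) / 2 * Z (S N)).
    - intros N; rewrite !HTW, Hsym; field; lra.
    - apply is_lim_seq_plus'; apply is_lim_seq_mult'; try apply is_lim_seq_const.
      + apply is_lim_seq_minus'; now apply HWl.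
      + exact HZl. }
  apply is_lim_seq_unique in HT; apply is_lim_seq_unique in HT2.
  rewrite HT in HT2; injection HT2 as E.
  apply (Rmult_eq_reg_l (PI / 2)); [|lra].
  transitivity (PI * (lambert 1 y - lambert 1 (/ y)) + (y - / y) / 2 * zeta 2
                - (y - / y) / 2 * zeta 2); [field; lra|].
  rewrite <- E; field; lra.
Qed.

(** * The divisor function and power series in exp(-2 pi y) *)

Section DivisorSigma.
Import mathcomp.boot.all_boot.
Local Open Scope nat_scope.

Lemma dvdn_eqb (d n : nat) : dvdn d.+1 n = Nat.eqb (Nat.modulo n d.+1) O.
Proof.
  apply/idP/idP.
  - by case/dvdnP=> k ->; rewrite -multE PeanoNat.Nat.Div0.mod_mul.
  - move/PeanoNat.Nat.eqb_eq/PeanoNat.Nat.Lcm0.mod_divide => H; case: H => k ->; exact: dvdn_mull.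
Qed.

Lemma divisor_sigma_sum (s n : nat) :
  divisor_sigma s n.+1 = \sum_(k < n.+1) if Nat.eqb (Nat.modulo n.+1 k.+1) O then k.+1 ^ s else 0.
Proof.
  rewrite /divisor_sigma -big_mkcond /=.
  rewrite -(big_mkord (fun k => Nat.eqb (Nat.modulo n.+1 k.+1) O) (fun k => k.+1 ^ s)).
  rewrite -(big_map S (fun d => Nat.eqb (Nat.modulo n.+1 d) O) (fun d => d ^ s)) -[RHS]big_filter.
  apply: perm_big; apply: uniq_perm.
  - exact: divisors_uniq.
  - by rewrite filter_uniq // map_inj_uniq ?iota_uniq //; exact: succn_inj.
  - move=> d; rewrite -dvdn_divisors // mem_filter.
    apply/idP/idP.
    + move=> dn; have d0 : 0 < d by case: d dn.
      have := dn; rewrite -(prednK d0) dvdn_eqb => ->; rewrite andTb.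
      rewrite mem_map; last exact: succn_inj.
      by rewrite mem_index_iota /= prednK // dvdn_leq.
    + by case/andP=> h /mapP [k _ e]; move: h; rewrite e dvdn_eqb.
Qed.

Lemma INR_sum (F : nat -> nat) (m : nat) :
  INR (\sum_(k < m) F k) = psum (fun k => INR (F k)) m.
Proof.
  elim: m => [|m IH]; first by rewrite big_ord0.
  by rewrite big_ord_recr /= -plusE plus_INR IH.
Qed.

Lemma INR_divisor_sigma (s n : nat) :
  INR (divisor_sigma s n.+1)
  = psum (fun k => if Nat.eqb (Nat.modulo n.+1 k.+1) O then pow (INR k.+1) s else R0) n.+1.
Proof.
  rewrite divisor_sigma_sum
    (INR_sum (fun k => if Nat.eqb (Nat.modulo n.+1 k.+1) O then k.+1 ^ s else 0)).
  apply: psum_ext => k _; case: ifP => // _.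
  elim: s => [|s IHs] //; by rewrite expnS -multE mult_INR IHs.
Qed.
End DivisorSigma.

(** The sequence [b] is spread over the multiples of [k + 1]. The quotient [N / (k + 1)] grows
    exactly when the remainder of [N] is [k], which is when the new term is nonzero. *)
Lemma psum_dilate (b : nat -> R) (k N : nat) :
  psum (fun n => if Nat.eqb (S n mod S k) 0 then b (pred (S n / S k)) else 0) N
  = psum b (N / S k).
Proof.
  induction N as [|N IH]; [now rewrite Nat.Div0.div_0_l|].
  cbn [psum]; rewrite IH.
  assert (E1 := Nat.div_mod_eq N (S k)); assert (L1 := Nat.mod_upper_bound N (S k) ltac:(lia)).
  set (q := (N / S k)%nat) in *; set (r := (N mod S k)%nat) in *.
  destruct (Nat.eq_dec r k) as [Hr|Hr].
  - assert (Hd : (S N / S k = S q)%nat)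
      by (symmetry; apply (Nat.div_unique (S N) (S k) (S q) 0); lia).
    assert (Hm : (S N mod S k = 0)%nat)
      by (symmetry; apply (Nat.mod_unique (S N) (S k) (S q) 0); lia).
    rewrite Hd, Hm; reflexivity.
  - assert (Hd : (S N / S k = q)%nat)
      by (symmetry; apply (Nat.div_unique (S N) (S k) q (S r)); lia).
    assert (Hm : (S N mod S k = S r)%nat)
      by (symmetry; apply (Nat.mod_unique (S N) (S k) q (S r)); lia).
    rewrite Hd, Hm; simpl; ring.
Qed.

Lemma is_series_dilate (b : nat -> R) (l : R) (k : nat) : is_series b l ->
  is_series (fun n => if Nat.eqb (S n mod S k) 0 then b (pred (S n / S k)) else 0) l.
Proof.
  intros H; apply is_series_psum; apply is_series_psum in H.
  apply is_lim_seq_ext with (fun N => psum b (N / S k)); [intros N; now rewrite psum_dilate|].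
  apply (is_lim_seq_subseq (psum b) l (fun N => (N / S k)%nat)); [|exact H].
  intros P [M HM]; exists (M * S k)%nat; intros N HN; apply HM.
  apply Nat.div_le_lower_bound; lia.
Qed.

(** Geometric expansion turns the Lambert series into the sum of [q^(m k) / m^s], which is regrouped
    by [n = m k]. For fixed [k] the sum over [m] is dilated by [k], turning [1 / m^s] into
    [k^s / n^s]; the sum over [k] dividing [n] is then [sigma_s(n) / n^s], with no appeal to the
    involution [d -> n / d]. *)
Lemma lambert_sigma (s : nat) (y : R) : (1 <= s)%nat -> 0 < y ->
  is_series (fun n => INR (divisor_sigma s (S n)) / INR (S n) ^ s * exp (- (2 * PI * y)) ^ S n)
    (lambert s y).
Proof.
  intros Hs Hy; assert (Hpi := PI_RGT_0).
  set (q := exp (- (2 * PI * y))).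
  assert (Hq : 0 < q < 1).
  { unfold q; split; [apply exp_pos | rewrite <- exp_0; apply exp_increasing; nra]. }
  assert (Hqn : forall n, 0 < q ^ n) by (intros n; apply pow_lt; lra).
  set (u := fun m k : nat => q ^ (S m * S k) / INR (S m) ^ s).
  assert (Hp : forall m, 0 < INR (S m) ^ s)
    by (intros m; apply pow_lt; generalize (INR_S_ge_1 m); lra).
  assert (Hu0 : forall m k, 0 <= u m k) by (intros m k; left; apply Rdiv_lt_0_compat; auto).
  assert (Hu : forall m, is_series (u m) (bose (INR (S m) * y) / INR (S m) ^ s)).
  { intros m; set (r := q ^ S m).
    assert (Hr : 0 < r < 1) by (unfold r; split; [auto | apply pow_lt_1_compat; [lra | lia]]).
    assert (E : exp (2 * PI * (INR (S m) * y)) = / r).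
    { unfold r, q; rewrite <- (Rpower_pow (S m)) by apply exp_pos.
      unfold Rpower; rewrite ln_exp, <- exp_Ropp; f_equal; ring. }
    unfold bose; rewrite E.
    assert (G := is_series_scal_l (r / INR (S m) ^ s) _ _
      (is_series_geom r ltac:(rewrite Rabs_pos_eq; lra))).
    match type of G with is_series _ ?v => match goal with |- is_series _ ?w =>
      replace w with v end end.
    - apply is_series_ext with (2 := G); intros k.
      match goal with |- scal ?a ?b = ?c => change (a * b = c :> R) end.
      unfold u; rewrite pow_mult; fold r; simpl (r ^ S k); specialize (Hp m); field; lra.
    - match goal with |- scal ?a ?b = ?c => change (a * b = c :> R) end.
      specialize (Hp m); field; lra. }
  assert (Hc := fubini_nonneg u _ _ Hu0 Hu (is_series_lambert s y Hs Hy)).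
  set (c := fun k => Series (fun m => u m k)) in Hc.
  assert (Hcol : forall k, is_series (fun m => u m k) (c k)).
  { intros k; apply Series_correct, (fubini_nonneg_ex u _ k Hu0 Hu).
    eexists; exact (is_series_lambert s y Hs Hy). }
  set (v := fun k n : nat =>
    if Nat.eqb (S n mod S k) 0 then INR (S k) ^ s / INR (S n) ^ s * q ^ S n else 0).
  apply (fubini_nonneg_cols v c _ (lambert s y)).
  - intros k n; unfold v; destruct (Nat.eqb _ _); [|lra].
    apply Rmult_le_pos; [apply Rdiv_le_0_compat; [left|]; auto | left; auto].
  - intros k; apply is_series_ext with (2 := is_series_dilate _ _ k (Hcol k)); intros n; unfold v.
    destruct (Nat.eqb_spec (S n mod S k) 0) as [Hd|Hd]; [|reflexivity].
    assert (E := Nat.div_mod_eq (S n) (S k)); rewrite Hd, Nat.add_0_r in E.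
    destruct (S n / S k)%nat as [|j] eqn:Ej; [lia|].
    unfold u; simpl pred; rewrite E, (Nat.mul_comm (S k)), mult_INR, Rpow_mult_distr.
    generalize (Hp j) (Hp k); intros; real_eq; field; lra.
  - exact Hc.
  - intros n; rewrite INR_divisor_sigma.
    assert (F := is_series_finite (fun k => v k n) (S n)).
    match goal with |- is_series _ ?w => replace w with (psum (fun k => v k n) (S n)) end.
    + apply F; intros k Hk; unfold v; rewrite Nat.mod_small by lia; reflexivity.
    + unfold Rdiv; rewrite Rmult_assoc, Rmult_comm, <- psum_scal.
      apply psum_ext; intros k _; unfold v; destruct (Nat.eqb _ _); [unfold Rdiv|]; ring.
Qed.

(** * Termwise differentiation of power series in [q = exp(-2 pi y)] *)

Lemma CV_radius_ge_1 (a : nat -> R) : (forall n, 0 <= a n) ->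
  (forall q, 0 < q < 1 -> ex_series (fun n => a n * q ^ n)) -> Rbar_le 1 (CV_radius a).
Proof.
  intros Ha H; apply Rbar_not_lt_le; intros Hlt.
  assert (H0 := CV_radius_ge_0 a).
  destruct (CV_radius a) as [r| |] eqn:Er; try contradiction.
  simpl in Hlt, H0.
  destruct (Lub_Rbar_correct (CV_disk a)) as [Hub _].
  change (Lub_Rbar (CV_disk a)) with (CV_radius a) in Hub; rewrite Er in Hub.
  assert (Hq : 0 < (r + 1) / 2 < 1) by lra.
  assert (Hle : Rbar_le ((r + 1) / 2) r).
  { apply Hub; unfold CV_disk.
    apply ex_series_ext with (2 := H _ Hq); intros n.
    rewrite Rabs_pos_eq; [reflexivity|].
    apply Rmult_le_pos; [apply Ha | apply pow_le; lra]. }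
  simpl in Hle; lra.
Qed.

Definition qseries (a : nat -> R) (y : R) : R := PSeries a (exp (- (2 * PI * y))).

Lemma q_lt_1 (a : nat -> R) (y : R) : Rbar_le 1 (CV_radius a) -> 0 < y ->
  Rbar_lt (Rabs (exp (- (2 * PI * y)))) (CV_radius a).
Proof.
  intros Ha Hy; assert (Hpi := PI_RGT_0).
  apply Rbar_lt_le_trans with 1; [|exact Ha].
  simpl; rewrite Rabs_pos_eq by (left; apply exp_pos).
  rewrite <- exp_0; apply exp_increasing; nra.
Qed.

(** On coefficients, [d/dy = -2 pi q d/dq]. *)
Definition qderiv (a : nat -> R) (n : nat) : R := - (2 * PI) * (INR n * a n).

Lemma qderiv_incr (a : nat -> R) (n : nat) :
  PS_scal (- (2 * PI)) (PS_incr_1 (PS_derive a)) n = qderiv a n.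
Proof.
  unfold qderiv, PS_scal, PS_incr_1, PS_derive.
  destruct n as [|n]; match goal with |- scal ?a ?b = ?c => change (a * b = c :> R) end.
  - simpl (INR 0); change (zero : R) with 0; ring.
  - reflexivity.
Qed.

Lemma CV_radius_qderiv (a : nat -> R) :
  Rbar_le 1 (CV_radius a) -> Rbar_le 1 (CV_radius (qderiv a)).
Proof.
  intros Ha; assert (Hpi := PI_RGT_0).
  rewrite <- (CV_radius_ext _ _ (qderiv_incr a)), CV_radius_scal by lra.
  now rewrite CV_radius_incr_1, CV_radius_derive.
Qed.

Lemma is_derive_qseries (a : nat -> R) (y : R) : Rbar_le 1 (CV_radius a) -> 0 < y ->
  is_derive (qseries a) y (qseries (qderiv a) y).
Proof.
  intros Ha Hy; set (q := exp (- (2 * PI * y))).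
  assert (Hd : is_derive (fun t => exp (- (2 * PI * t))) y (- (2 * PI) * q))
    by (unfold q; auto_derive; [auto | ring]).
  assert (H := is_derive_comp (PSeries a) _ y _ _ (is_derive_PSeries a _ (q_lt_1 a y Ha Hy)) Hd).
  evar_last; [exact H|].
  match goal with |- scal ?a ?b = ?c => change (a * b = c :> R) end.
  unfold qseries; fold q.
  rewrite <- (PSeries_ext _ _ _ (qderiv_incr a)), PSeries_scal, PSeries_incr_1; ring.
Qed.

(* The case split avoids the junk value of [/ 0 ^ s]. *)
Definition sigma_coeff (s n : nat) : R :=
  match n with O => 0 | S _ => INR (divisor_sigma s n) / INR n ^ s end.

(** The [j]-th derivative of [lambert s] on [y > 0], by [sigma_deriv_0] and [is_derive_sigma];
    indexing by [j] gives the family [f] of the reciprocity lemmas. *)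
Definition sigma_deriv (s j : nat) : R -> R := qseries (Nat.iter j qderiv (sigma_coeff s)).

Lemma CV_radius_sigma (s j : nat) : (1 <= s)%nat ->
  Rbar_le 1 (CV_radius (Nat.iter j qderiv (sigma_coeff s))).
Proof.
  intros Hs; induction j as [|j IH]; simpl; [|now apply CV_radius_qderiv].
  apply CV_radius_ge_1.
  - intros [|n]; unfold sigma_coeff; [lra|].
    apply Rdiv_le_0_compat; [apply pos_INR | apply pow_lt; generalize (INR_S_ge_1 n); lra].
  - intros q Hq; apply ex_series_incr_1.
    assert (Hpi := PI_RGT_0).
    (* The [y] with [exp (- (2 * PI * y)) = q], at which [lambert_sigma] gives convergence. *)
    assert (Hy : 0 < - ln q / (2 * PI)).
    { apply Rdiv_lt_0_compat; [|lra]; assert (ln q < ln 1) by (apply ln_increasing; lra).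
      rewrite ln_1 in *; lra. }
    eexists; apply is_series_ext with (2 := lambert_sigma s _ Hs Hy); intros n.
    replace (- (2 * PI * (- ln q / (2 * PI)))) with (ln q) by (field; lra).
    rewrite exp_ln by lra; reflexivity.
Qed.

Lemma is_derive_sigma (s j : nat) (y : R) : (1 <= s)%nat -> 0 < y ->
  is_derive (sigma_deriv s j) y (sigma_deriv s (S j) y).
Proof. intros Hs Hy; apply is_derive_qseries; [now apply CV_radius_sigma | exact Hy]. Qed.

Lemma iter_qderiv (j n : nat) (a : nat -> R) :
  Nat.iter j qderiv a n = (- (2 * PI) * INR n) ^ j * a n.
Proof.
  induction j as [|j IH]; simpl; [ring|].
  unfold qderiv at 1; rewrite IH; ring.
Qed.

Lemma is_series_sigma (s j : nat) (y : R) : (1 <= s)%nat -> 0 < y ->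
  is_series (fun n => (- (2 * PI) * INR (S n)) ^ j * (INR (divisor_sigma s (S n)) / INR (S n) ^ s)
                      * exp (- (2 * PI * y * INR (S n)))) (sigma_deriv s j y).
Proof.
  intros Hs Hy.
  set (a := Nat.iter j qderiv (sigma_coeff s)).
  assert (H := CV_radius_inside a _ (q_lt_1 a y (CV_radius_sigma s j Hs) Hy)).
  apply PSeries_correct, is_pseries_R in H.
  (* The power series starts at index 0, the sum over [n] at 1. For [j = 0], where [0 ^ 0 = 1], the
     vanishing rests on [sigma_coeff s 0 = 0]. *)
  assert (H0 : a O * exp (- (2 * PI * y)) ^ 0 = 0)
    by (unfold a; rewrite iter_qderiv; unfold sigma_coeff; ring).
  assert (H1 := is_series_tail _ _ 1 H); cbn [psum] in H1.
  rewrite H0 in H1.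
  match type of H1 with is_series _ ?v => match goal with |- is_series _ ?w =>
    replace w with v end end.
  - apply is_series_ext with (2 := H1); intros n; cbn [Nat.add].
    unfold a; rewrite iter_qderiv; unfold sigma_coeff at 1; f_equal.
    rewrite <- (Rpower_pow (S n)) by apply exp_pos.
    unfold Rpower; rewrite ln_exp; f_equal; ring.
  - unfold sigma_deriv, qseries; fold a; ring.
Qed.

Lemma sigma_deriv_0 (s : nat) (y : R) : (1 <= s)%nat -> 0 < y -> sigma_deriv s 0 y = lambert s y.
Proof.
  intros Hs Hy.
  rewrite <- (is_series_unique _ _ (is_series_sigma s 0 y Hs Hy)).
  apply is_series_unique, is_series_ext with (2 := lambert_sigma s y Hs Hy); intros n.
  rewrite <- (Rpower_pow (S n)) by apply exp_pos.
  unfold Rpower; rewrite ln_exp, pow_O, Rmult_1_l; do 2 f_equal; ring.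
Qed.

(** * Differentiating the reciprocity relations *)

Lemma derive_eq (g h g' h' : R -> R) :
  (forall y, 0 < y -> g y = h y) ->
  (forall y, 0 < y -> is_derive g y (g' y)) ->
  (forall y, 0 < y -> is_derive h y (h' y)) ->
  forall y, 0 < y -> g' y = h' y.
Proof.
  intros E Hg Hh y Hy.
  rewrite <- (is_derive_unique _ _ _ (Hg y Hy)); apply is_derive_unique.
  apply (is_derive_ext_loc h); [|now apply Hh].
  (* The equality is known on the positive axis only; the ball of radius [y] around [y] stays inside
     it. *)
  exists (mkposreal y Hy); intros t Ht; symmetry; apply E.
  apply Rabs_def2 in Ht; unfold minus, plus, opp in Ht; simpl in Ht; lra.
Qed.


(** Differentiates both sides of [E]; [Hf] replaces the derivatives of [f j], at [y] and at [/ y],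
    by [f (S j)]. *)
Ltac derive_sides f Hf E :=
  refine (derive_eq _ _ _ _ E _ _);
  let y := fresh "y" in let Hy := fresh "Hy" in let Hy' := fresh "Hy'" in
  intros y Hy; assert (Hy' := Rinv_0_lt_compat y Hy); auto_derive;
  rewrite ?(fun j => is_derive_unique (fun t => f j t) _ _ (Hf j y Hy)),
    ?(fun j => is_derive_unique (fun t => f j t) _ _ (Hf j (/ y) Hy'));
  try (field; lra);
  repeat split; try (repeat apply Rmult_integral_contrapositive_currified; lra);
  eexists; apply Hf; assumption.

(** At [y = 1], half of the third relation is [f 3 + 3 f 2 + 3 f 1 = - 3 K + 1/2] and the first is
    [2 f 1 = - 2 K + 1/2]. Their difference removes the constant coming from the logarithm. *)
Lemma reciprocity_derivatives_weight_2 (f : nat -> R -> R) (K : R) :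
  (forall j y, 0 < y -> is_derive (f j) y (f (S j) y)) ->
  (forall y, 0 < y -> f 0%nat y - f 0%nat (/ y) = K * (/ y - y) + ln y / 2) ->
  f 3%nat 1 + 3 * f 2%nat 1 + f 1%nat 1 = - K.
Proof.
  intros Hf E0.
  assert (E1 : forall y, 0 < y ->
    f 1%nat y + / y ^ 2 * f 1%nat (/ y) = K * (- / y ^ 2 - 1) + / y / 2) by derive_sides f Hf E0.
  assert (E2 : forall y, 0 < y ->
    f 2%nat y - 2 * / y ^ 3 * f 1%nat (/ y) - / y ^ 4 * f 2%nat (/ y)
    = 2 * K * / y ^ 3 - / y ^ 2 / 2) by derive_sides f Hf E1.
  assert (E3 : forall y, 0 < y ->
    f 3%nat y + 6 * / y ^ 4 * f 1%nat (/ y) + 6 * / y ^ 5 * f 2%nat (/ y)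
      + / y ^ 6 * f 3%nat (/ y)
    = - 6 * K * / y ^ 4 + / y ^ 3) by derive_sides f Hf E2.
  specialize (E1 1 Rlt_0_1); specialize (E3 1 Rlt_0_1).
  rewrite !pow1, Rinv_1 in *; lra.
Qed.

(* Bol's identity: the lower derivatives cancel in the third derivative here, and in the fifth
   one in weight 6. *)
Lemma reciprocity_derivatives_weight_4 (f : nat -> R -> R) (K c z : R) :
  (forall j y, 0 < y -> is_derive (f j) y (f (S j) y)) ->
  (forall y, 0 < y -> f 0%nat y + y ^ 2 * f 0%nat (/ y)
    = K * (/ y + y ^ 3) + c * y - z * (1 + y ^ 2)) ->
  f 4%nat 1 + 2 * f 3%nat 1 = 12 * K.
Proof.
  intros Hf E0.
  assert (E1 : forall y, 0 < y -> f 1%nat y + 2 * y * f 0%nat (/ y) - f 1%nat (/ y)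
    = K * (- / y ^ 2 + 3 * y ^ 2) + c - 2 * z * y) by derive_sides f Hf E0.
  assert (E2 : forall y, 0 < y ->
    f 2%nat y + 2 * f 0%nat (/ y) - 2 * / y * f 1%nat (/ y) + / y ^ 2 * f 2%nat (/ y)
    = K * (2 * / y ^ 3 + 6 * y) - 2 * z) by derive_sides f Hf E1.
  assert (E3 : forall y, 0 < y ->
    f 3%nat y - / y ^ 4 * f 3%nat (/ y) = K * (- 6 * / y ^ 4 + 6)) by derive_sides f Hf E2.
  (* At [y = 1] both sides of [E3] vanish, so one more derivative is taken. *)
  assert (E4 : forall y, 0 < y ->
    f 4%nat y + 4 * / y ^ 5 * f 3%nat (/ y) + / y ^ 6 * f 4%nat (/ y)
    = K * (24 * / y ^ 5)) by derive_sides f Hf E3.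
  specialize (E4 1 Rlt_0_1).
  rewrite !pow1, Rinv_1 in *; lra.
Qed.

(** The sign opposite to weight 4 makes the two fifth derivatives add up at [y = 1], so no further
    order is needed and a single derivative is determined. The terms in [c] and [z] have degree at
    most 4 and disappear. *)
Lemma reciprocity_derivatives_weight_6 (f : nat -> R -> R) (K c z : R) :
  (forall j y, 0 < y -> is_derive (f j) y (f (S j) y)) ->
  (forall y, 0 < y -> f 0%nat y - y ^ 4 * f 0%nat (/ y)
    = K * (/ y - y ^ 5) + c * (y - y ^ 3) + z * (y ^ 4 - 1)) ->
  f 5%nat 1 = - 120 * K.
Proof.
  intros Hf E0.
  assert (E1 : forall y, 0 < y ->
    f 1%nat y - 4 * y ^ 3 * f 0%nat (/ y) + y ^ 2 * f 1%nat (/ y)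
    = K * (- / y ^ 2 - 5 * y ^ 4) + c * (1 - 3 * y ^ 2) + 4 * z * y ^ 3) by derive_sides f Hf E0.
  assert (E2 : forall y, 0 < y ->
    f 2%nat y - 12 * y ^ 2 * f 0%nat (/ y) + 6 * y * f 1%nat (/ y) - f 2%nat (/ y)
    = K * (2 * / y ^ 3 - 20 * y ^ 3) - 6 * c * y + 12 * z * y ^ 2) by derive_sides f Hf E1.
  assert (E3 : forall y, 0 < y ->
    f 3%nat y - 24 * y * f 0%nat (/ y) + 18 * f 1%nat (/ y) - 6 * / y * f 2%nat (/ y)
      + / y ^ 2 * f 3%nat (/ y)
    = K * (- 6 * / y ^ 4 - 60 * y ^ 2) - 6 * c + 24 * z * y) by derive_sides f Hf E2.
  assert (E4 : forall y, 0 < y ->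
    f 4%nat y - 24 * f 0%nat (/ y) + 24 * / y * f 1%nat (/ y) - 12 * / y ^ 2 * f 2%nat (/ y)
      + 4 * / y ^ 3 * f 3%nat (/ y) - / y ^ 4 * f 4%nat (/ y)
    = K * (24 * / y ^ 5 - 120 * y) + 24 * z) by derive_sides f Hf E3.
  assert (E5 : forall y, 0 < y ->
    f 5%nat y + / y ^ 6 * f 5%nat (/ y) = K * (- 120 * / y ^ 6 - 120)) by derive_sides f Hf E4.
  specialize (E5 1 Rlt_0_1).
  rewrite !pow1, Rinv_1 in *; lra.
Qed.

Theorem corollary3 :
  is_series (fun k : nat => let n := S k in
      INR (divisor_sigma 1 n) * (2 * PI * INR n * (2 * PI * INR n - 3) + 1)
        * exp (- (2 * PI * INR n))) (1 / 24) /\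
  is_series (fun k : nat => let n := S k in
      INR (divisor_sigma 3 n) * (PI * INR n - 1) * exp (- (2 * PI * INR n)))
      (1 / 240) /\
  is_series (fun k : nat => let n := S k in
      INR (divisor_sigma 5 n) * exp (- (2 * PI * INR n))) (1 / 504).
Proof.
  assert (Hpi := PI_RGT_0); destruct zeta_values as [Z2 [Z4 Z6]].
  assert (L : forall s j, (1 <= s)%nat ->
    is_series (fun n => (- (2 * PI) * INR (S n)) ^ j
      * (INR (divisor_sigma s (S n)) / INR (S n) ^ s) * exp (- (2 * PI * INR (S n))))
      (sigma_deriv s j 1)).
  { intros s j Hs; apply is_series_ext with (2 := is_series_sigma s j 1 Hs Rlt_0_1).
    intros n; now rewrite Rmult_1_r. }
  repeat split; cbv zeta.
  - assert (E := reciprocity_derivatives_weight_2 (sigma_deriv 1)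
      (PI / 12)
      (fun j y => is_derive_sigma 1 j y ltac:(lia))).
    lapply E; clear E; [intros E | intros y Hy].
    2: { rewrite !sigma_deriv_0 by (try lia; try apply Rinv_0_lt_compat; exact Hy).
         generalize (lambert_1_reciprocity y Hy); rewrite Z2.
         replace (PI ^ 2 / 6 / PI) with (PI / 6) by (field; lra); lra. }
    (* With [x = 2 pi n], the three orders give [sigma_1(n)] times [- 2 pi (x^2 - 3 x + 1)]; the
       factor also turns [- PI / 12] into [1 / 24]. *)
    assert (H := is_series_scal_l (- / (2 * PI)) _ _ (is_series_plus _ _ _ _ (is_series_plus _ _ _ _
      (L 1%nat 3%nat ltac:(lia)) (is_series_scal_l 3 _ _ (L 1%nat 2%nat ltac:(lia))))
      (L 1%nat 1%nat ltac:(lia)))).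
    match type of H with is_series _ ?v => replace (1 / 24) with v end.
    + apply is_series_ext with (2 := H); intros n; assert (Hn := INR_S_ge_1 n).
      generalize dependent (INR (S n)); intros x Hx.
      generalize (INR (divisor_sigma 1 (S n))) (exp (- (2 * PI * x))); intros s e.
      match goal with |- ?a = ?b =>
        change (- / (2 * PI) * (((- (2 * PI) * x) ^ 3 * (s / x ^ 1) * e
        + 3 * ((- (2 * PI) * x) ^ 2 * (s / x ^ 1) * e))
        + (- (2 * PI) * x) ^ 1 * (s / x ^ 1) * e) = b :> R) end.
      field; lra.
    + match goal with |- _ = ?b =>
        change (- / (2 * PI)
          * (sigma_deriv 1 3 1 + 3 * sigma_deriv 1 2 1 + sigma_deriv 1 1 1) = b :> R) end.
      rewrite E; field; lra.
  (* [K] is half of [zeta 4 / PI]. The value [zeta 3] enters unevaluated, in a polynomial of degree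
     2 that the derivatives remove; [zeta 5] does likewise in weight 6. *)
  - assert (E := reciprocity_derivatives_weight_4 (sigma_deriv 3)
      (PI ^ 3 / 180) (zeta 2 ^ 2 / PI) (zeta 3 / 2)
      (fun j y => is_derive_sigma 3 j y ltac:(lia))).
    lapply E; clear E; [intros E | intros y Hy].
    2: { rewrite !sigma_deriv_0 by (try lia; try apply Rinv_0_lt_compat; exact Hy).
         generalize (lambert_3_reciprocity y Hy); rewrite Z4.
         replace (PI ^ 4 / 90 / PI) with (PI ^ 3 / 90) by (field; lra); lra. }
    (* The coefficients are [sigma_3(n)] times [16 PI^4 n - 16 PI^3], and [12 K = PI^3 / 15]. *)
    assert (H := is_series_scal_l (/ (16 * PI ^ 3)) _ _ (is_series_plus _ _ _ _
      (L 3%nat 4%nat ltac:(lia)) (is_series_scal_l 2 _ _ (L 3%nat 3%nat ltac:(lia))))).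
    match type of H with is_series _ ?v => replace (1 / 240) with v end.
    + apply is_series_ext with (2 := H); intros n; assert (Hn := INR_S_ge_1 n).
      generalize dependent (INR (S n)); intros x Hx.
      generalize (INR (divisor_sigma 3 (S n))) (exp (- (2 * PI * x))); intros s e.
      match goal with |- ?a = ?b =>
        change (/ (16 * PI ^ 3) * ((- (2 * PI) * x) ^ 4 * (s / x ^ 3) * e
        + 2 * ((- (2 * PI) * x) ^ 3 * (s / x ^ 3) * e)) = b :> R) end.
      field; lra.
    + match goal with |- _ = ?b =>
        change (/ (16 * PI ^ 3) * (sigma_deriv 3 4 1 + 2 * sigma_deriv 3 3 1) = b :> R) end.
      rewrite E; field; lra.
  - assert (E := reciprocity_derivatives_weight_6 (sigma_deriv 5)
      (PI ^ 5 / 1890) (zeta 2 * zeta 4 / PI) (zeta 5 / 2)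
      (fun j y => is_derive_sigma 5 j y ltac:(lia))).
    lapply E; clear E; [intros E | intros y Hy].
    2: { rewrite !sigma_deriv_0 by (try lia; try apply Rinv_0_lt_compat; exact Hy).
         generalize (lambert_5_reciprocity y Hy); rewrite Z6.
         replace (PI ^ 6 / 945 / PI) with (PI ^ 5 / 945) by (field; lra); lra. }
    (* The fifth derivative has coefficients [- 32 PI^5 sigma_5(n)], and [120 K = 4 PI^5 / 63]. *)
    assert (H := is_series_scal_l (- / (32 * PI ^ 5)) _ _ (L 5%nat 5%nat ltac:(lia))).
    match type of H with is_series _ ?v => replace (1 / 504) with v end.
    + apply is_series_ext with (2 := H); intros n; assert (Hn := INR_S_ge_1 n).
      generalize dependent (INR (S n)); intros x Hx.
      generalize (INR (divisor_sigma 5 (S n))) (exp (- (2 * PI * x))); intros s e.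
      match goal with |- ?a = ?b =>
        change (- / (32 * PI ^ 5) * ((- (2 * PI) * x) ^ 5 * (s / x ^ 5) * e)
        = b :> R) end.
      field; lra.
    + match goal with |- _ = ?b =>
        change (- / (32 * PI ^ 5) * sigma_deriv 5 5 1 = b :> R) end.
      rewrite E; field; lra.
Qed.
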